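(* Let $R$ be a unital associative ring such that both invariants $\mathrm{spli}\, R$ and $\mathrm{spli}\, R^{op}$ are finite. Then $\mathrm{silp}\, R = \mathrm{spli}\, R$ and $\mathrm{silp}\, R^{op} = \mathrm{spli}\, R^{op}$.
   Context: $\mathrm{spli}\, R$ is the supremum of the projective dimensions of injective left $R$-modules and $\mathrm{silp}\, R$ is the supremum of the injective dimensions of projective left $R$-modules (suprema in $\mathbb{N}\cup\{\infty\}$). $R^{op}$ is the opposite ring; $\mathrm{spli}\, R^{op}$ and $\mathrm{silp}\, R^{op}$ are the corresponding invariants for right $R$-modules. *)

(* Defs.v *)
From HB Require Import structures.
From mathcomp Require Import all_boot all_order all_algebra.
From mathcomp Require Import boolp classical_sets.

Set Implicit Arguments.
Unset Strict Implicit.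
Unset Printing Implicit Defensive.

Import GRing.Theory.

Local Open Scope classical_set_scope.
Local Open Scope ring_scope.

(* The set N u {oo}, with [None] standing for oo. *)
Definition natbar : Type := option nat.
Definition natbar_oo : natbar := None.

Definition natbar_le (x y : natbar) : bool :=
  match x, y with
  | _, None => true
  | None, Some _ => false
  | Some m, Some n => (m <= n)%N
  end.

Definition natbar_inf (A : set nat) : natbar :=
  match pselect (exists n, `[< A n >]) with
  | left exA => Some (ex_minn exA)
  | right _ => None
  end.

(* A least upper bound: see [natbar_sup_ub] and [natbar_sup_least]. *)
Definition natbar_sup (S : set natbar) : natbar :=
  natbar_inf [set n | forall x, S x -> natbar_le x (Some n)].

Lemma natbar_inf_lb (A : set nat) n : A n -> natbar_le (natbar_inf A) (Some n).
Proof.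
move=> An; rewrite /natbar_inf; case: pselect => [exA|[]] /=.
  by case: ex_minnP => m _; apply; apply/asboolP.
by exists n; apply/asboolP.
Qed.

Lemma natbar_inf_mem (A : set nat) n : natbar_inf A = Some n -> A n.
Proof.
rewrite /natbar_inf; case: pselect => [exA|//] [<-].
by case: ex_minnP => m /asboolP.
Qed.

Lemma natbar_sup_ub (S : set natbar) x : S x -> natbar_le x (natbar_sup S).
Proof.
move=> Sx; case E: (natbar_sup S) => [n|]; last by case: x {Sx}.
exact: (natbar_inf_mem E).
Qed.

Lemma natbar_sup_least (S : set natbar) y :
  (forall x, S x -> natbar_le x y) -> natbar_le (natbar_sup S) y.
Proof.
case: y => [n|_]; last by case: (natbar_sup S).
exact: (@natbar_inf_lb [set m | forall x, S x -> natbar_le x (Some m)]).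
Qed.

Definition is_projective (R : pzRingType) (P : lmodType R) : Prop :=
  forall (A B : lmodType R) (g : {linear A -> B}) (f : {linear P -> B}),
    (forall b, exists a, g a = b) ->
    exists h : {linear P -> A}, forall x, g (h x) = f x.

Definition is_injective (R : pzRingType) (I : lmodType R) : Prop :=
  forall (A B : lmodType R) (i : {linear A -> B}) (f : {linear A -> I}),
    injective i ->
    exists h : {linear B -> I}, forall x, h (i x) = f x.

Definition exact_at (R : pzRingType) (A B C : lmodType R)
    (f : {linear A -> B}) (g : {linear B -> C}) : Prop :=
  forall y, g y = 0 <-> exists x, f x = y.

Definition is_zero_module (R : pzRingType) (M : lmodType R) : Prop :=
  forall x : M, x = 0.

(* ... -> P_2 -> P_1 -> P_0 -> M -> 0 *)
Record projective_resolution (R : pzRingType) (M : lmodType R) := {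
  pres_obj :> nat -> lmodType R;
  pres_diff : forall i, {linear pres_obj i.+1 -> pres_obj i};
  pres_aug : {linear pres_obj 0%N -> M};
  pres_proj : forall i, is_projective (pres_obj i);
  pres_aug_surj : forall m, exists x, pres_aug x = m;
  pres_exact0 : exact_at (pres_diff 0%N) pres_aug;
  pres_exactS : forall i, exact_at (pres_diff i.+1) (pres_diff i)
}.

(* 0 -> M -> I^0 -> I^1 -> I^2 -> ... *)
Record injective_resolution (R : pzRingType) (M : lmodType R) := {
  ires_obj :> nat -> lmodType R;
  ires_diff : forall i, {linear ires_obj i -> ires_obj i.+1};
  ires_aug : {linear M -> ires_obj 0%N};
  ires_inj : forall i, is_injective (ires_obj i);
  ires_aug_inj : injective ires_aug;
  ires_exact0 : exact_at ires_aug (ires_diff 0%N);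
  ires_exactS : forall i, exact_at (ires_diff i) (ires_diff i.+1)
}.

(* The zero module gets dimension 0, the least element of N u {oo}. *)
Definition projdim (R : pzRingType) (M : lmodType R) : natbar :=
  natbar_inf [set n | exists P : projective_resolution M,
                        forall i, (n < i)%N -> is_zero_module (P i)].

Definition injdim (R : pzRingType) (M : lmodType R) : natbar :=
  natbar_inf [set n | exists I : injective_resolution M,
                        forall i, (n < i)%N -> is_zero_module (I i)].

Definition spli (R : pzRingType) : natbar :=
  natbar_sup [set d | exists2 I : lmodType R, is_injective I & projdim I = d].

Definition silp (R : pzRingType) : natbar :=
  natbar_sup [set d | exists2 P : lmodType R, is_projective P & injdim P = d].

(* Main.v *)
(* Let every injective left module have projective dimension at most n and every
   injective right module projective dimension at most m.  For P projective,
   let C_j be the j-th cosyzygy of P in its injective coresolution.  By the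
   horseshoe lemma the modules F_j = Omega^n C_j fit into exact sequences
   0 -> F_j -> Q_j -> F_{j+1} -> 0 with Q_j projective, and F_0 is projective, so
   F_j has projective dimension at most j.  Hence its character module has finite
   injective dimension over the opposite ring, therefore at most m, so that the
   character modules of Omega^m F_j are injective: these modules are flat.
   An exact complex 0 -> T_0 -> T_1 -> ... of projectives with flat cycles is
   contractible (Benson-Goodearl), so all the Omega^m F_j are projective and the
   C_j have projective dimension at most N = n + m.  Then
   Ext^1(C_{N+1}, C_N) = Ext^{N+1}(C_{N+1}, P) = 0, so 0 -> C_N -> E_N -> C_{N+1} -> 0
   splits, C_N is injective and P has injective dimension at most N.  Once both
   invariants are known to be finite, dimension shifting makes them equal.

   No Ext or Tor is constructed: Ext^{k+1}(M, X) = 0 is expressed by the vanishing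
   of Ext^1(M, Sigma^k X), and flatness by injectivity of the character module. *)

From HB Require Import structures.
Require Import Defs.
From mathcomp Require Import all_boot all_order all_algebra all_field.
From mathcomp Require Import boolp classical_sets functions.

Set Implicit Arguments.
Unset Strict Implicit.
Unset Printing Implicit Defensive.

Import GRing.Theory.

Local Open Scope ring_scope.


Definition mklin (R : pzRingType) (U V : lmodType R) (f : U -> V)
    (linf : linear f) : {linear U -> V} :=
  HB.pack f (GRing.isLinear.Build R U V _ f linf).

Definition mkadd (U V : zmodType) (f : U -> V) (addf : zmod_morphism f) :
    {additive U -> V} :=
  HB.pack f (GRing.isZmodMorphism.Build U V f addf).

(** * Submodules, quotients and short exact sequences *)

Lemma fun_choice (A B : Type) (P : A -> B -> Prop) :
  (forall x, exists y, P x y) -> exists f : A -> B, forall x, P x (f x).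
Proof.
by move=> H; exists (fun x => projT1 (cid (H x))) => x; case: cid.
Qed.

Section Submodule.
Context {R : pzRingType}.

Record submod (V : lmodType R) := Submod {
  smP :> V -> Prop;
  sm0 : smP 0;
  smL : forall a x y, smP x -> smP y -> smP (a *: x + y) }.

Variables (V : lmodType R) (P : submod V).

Lemma smD x y : P x -> P y -> P (x + y).
Proof. by move=> Px Py; rewrite -[x]scale1r; apply: smL. Qed.

Lemma smZ a x : P x -> P (a *: x).
Proof. by move=> Px; rewrite -[_ *: _]addr0; apply: smL => //; apply: sm0. Qed.

Lemma smN x : P x -> P (- x).
Proof. by rewrite -scaleN1r; apply: smZ. Qed.

Lemma smB x y : P x -> P y -> P (x - y).
Proof. by move=> Px Py; apply: smD => //; apply: smN. Qed.

(** The predicate is made boolean so that elements with the same underlying vector are equal. *)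
Definition sub : Type := {x : V | `[< P x >]}.
HB.instance Definition _ := Choice.on sub.

Definition sub_intro x (Px : P x) : sub := exist _ x (asboolT Px).

Lemma sub_valP (x : sub) : P (val x).
Proof. exact: asboolW (valP x). Qed.

Let zero : sub := sub_intro (sm0 P).
Let opp (x : sub) : sub := sub_intro (smN (sub_valP x)).
Let add (x y : sub) : sub := sub_intro (smD (sub_valP x) (sub_valP y)).
Let scale a (x : sub) : sub := sub_intro (smZ a (sub_valP x)).

Fact sub_addA : associative add.
Proof. by move=> x y z; apply: val_inj; rewrite /= addrA. Qed.
Fact sub_addC : commutative add.
Proof. by move=> x y; apply: val_inj; rewrite /= addrC. Qed.
Fact sub_add0 : left_id zero add.
Proof. by move=> x; apply: val_inj; rewrite /= add0r. Qed.
Fact sub_addN : left_inverse zero opp add.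
Proof. by move=> x; apply: val_inj; rewrite /= addNr. Qed.
HB.instance Definition _ := GRing.isZmodule.Build sub
  sub_addA sub_addC sub_add0 sub_addN.

Fact sub_scaleA a b v : scale a (scale b v) = scale (a * b) v.
Proof. by apply: val_inj; rewrite /= scalerA. Qed.
Fact sub_scale1 : left_id 1 scale.
Proof. by move=> v; apply: val_inj; rewrite /= scale1r. Qed.
Fact sub_scaleDr : right_distributive scale +%R.
Proof. by move=> a u v; apply: val_inj; rewrite /= scalerDr. Qed.
Fact sub_scaleDl v : {morph scale^~ v : a b / a + b}.
Proof. by move=> a b; apply: val_inj; rewrite /= scalerDl. Qed.
HB.instance Definition _ := GRing.Zmodule_isLmodule.Build R sub
  sub_scaleA sub_scale1 sub_scaleDr sub_scaleDl.

Definition sub_incl : {linear sub -> V} :=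
  mklin (f := fun x : sub => val x) (fun _ _ _ => erefl).

Lemma sub_incl_inj : injective sub_incl.
Proof. exact: val_inj. Qed.

Lemma sub_lift (U : lmodType R) (f : {linear U -> V}) :
  (forall x, P (f x)) -> exists g : {linear U -> sub}, forall x, val (g x) = f x.
Proof.
move=> Pf; have lin : linear (fun x => sub_intro (Pf x)).
  by move=> a x y; apply: val_inj; rewrite /= linearP.
by exists (mklin lin).
Qed.

(* The quotient is carried by canonical representatives of the cosets:
   [choose] only depends on the extension of its predicate. *)
Let rep (x : V) : V := choose (fun y => `[< P (x - y) >]) x.

Lemma repP x : P (x - rep x).
Proof.
have /asboolP//: `[< P (x - rep x) >].
apply: (@chooseP _ (fun y => `[< P (x - y) >])); apply/asboolP.
by rewrite subrr; apply: sm0.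
Qed.

Lemma rep_eq x y : P (x - y) -> rep x = rep y.
Proof.
move=> Pxy; rewrite /rep.
have E : (fun z => `[< P (x - z) >]) =1 (fun z => `[< P (y - z) >]).
  move=> z; apply: asbool_equiv_eq; split => H.
    by rewrite -(subrKA x); apply: smD => //; rewrite -opprB; apply: smN.
  by rewrite -(subrKA y); apply: smD.
rewrite (eq_choose E); apply: choose_id; apply/asboolP.
  by rewrite -opprB; apply: smN.
by rewrite subrr; apply: sm0.
Qed.

Lemma eq_rep x y : rep x = rep y -> P (x - y).
Proof.
move=> E; have := smB (repP x) (repP y).
by rewrite E opprB addrA subrK.
Qed.

Lemma rep_id x : rep (rep x) = rep x.
Proof. by apply: rep_eq; rewrite -opprB; apply: smN; apply: repP. Qed.

Definition quot : Type := {x : V | rep x == x}.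
HB.instance Definition _ := Choice.on quot.

Let proj (x : V) : quot := exist _ (rep x) (introT eqP (rep_id x)).

Let proj_val (x : quot) : proj (val x) = x.
Proof. by apply: val_inj; apply/eqP; apply: (valP x). Qed.

Let proj_eq x y : P (x - y) -> proj x = proj y.
Proof. by move=> Pxy; apply: val_inj; apply: rep_eq. Qed.

Let qadd (x y : quot) := proj (val x + val y).
Let qopp (x : quot) := proj (- val x).
Let qscale a (x : quot) := proj (a *: val x).

Let qaddE x y : qadd (proj x) (proj y) = proj (x + y).
Proof.
apply: proj_eq => /=; rewrite -opprB; apply: smN.
by rewrite opprD addrACA; apply: smD; apply: repP.
Qed.
Let qoppE x : qopp (proj x) = proj (- x).
Proof. by apply: proj_eq; rewrite /= opprK addrC; apply: repP. Qed.
Let qscaleE a x : qscale a (proj x) = proj (a *: x).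
Proof.
apply: proj_eq; rewrite /= -scalerBr; apply: smZ.
by rewrite -opprB; apply: smN; apply: repP.
Qed.

Let qind (Q : quot -> Prop) : (forall x, Q (proj x)) -> forall x, Q x.
Proof. by move=> H x; rewrite -(proj_val x). Qed.

Fact quot_addA : associative qadd.
Proof. by elim/qind => x; elim/qind => y; elim/qind => z; rewrite !qaddE addrA. Qed.
Fact quot_addC : commutative qadd.
Proof. by move=> x y; rewrite /qadd addrC. Qed.
Fact quot_add0 : left_id (proj 0) qadd.
Proof. by elim/qind => x; rewrite qaddE add0r. Qed.
Fact quot_addN : left_inverse (proj 0) qopp qadd.
Proof. by elim/qind => x; rewrite qoppE qaddE addNr. Qed.
HB.instance Definition _ := GRing.isZmodule.Build quot
  quot_addA quot_addC quot_add0 quot_addN.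

Fact quot_scaleA a b v : qscale a (qscale b v) = qscale (a * b) v.
Proof. by elim/qind: v => v; rewrite !qscaleE scalerA. Qed.
Fact quot_scale1 : left_id 1 qscale.
Proof. by elim/qind => v; rewrite qscaleE scale1r. Qed.
Fact quot_scaleDr : right_distributive qscale +%R.
Proof.
move=> a; elim/qind => u; elim/qind => v.
rewrite -[LHS]/(qscale a (qadd _ _)) -[RHS]/(qadd _ _).
by rewrite qaddE !qscaleE qaddE scalerDr.
Qed.
Fact quot_scaleDl v : {morph qscale^~ v : a b / a + b}.
Proof.
move=> a b; elim/qind: v => v; rewrite -[RHS]/(qadd _ _).
by rewrite !qscaleE qaddE scalerDl.
Qed.
HB.instance Definition _ := GRing.Zmodule_isLmodule.Build R quot
  quot_scaleA quot_scale1 quot_scaleDr quot_scaleDl.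

Fact quot_proj_linear : linear proj.
Proof. by move=> a x y; rewrite -[RHS]/(qadd (qscale _ _) _) qscaleE qaddE. Qed.

Definition quot_proj : {linear V -> quot} := mklin quot_proj_linear.

Lemma quot_proj_surj y : exists x, quot_proj x = y.
Proof. by exists (val y); apply: proj_val. Qed.

Lemma quot_proj_eq0 x : quot_proj x = 0 <-> P x.
Proof.
split=> [/(congr1 val)/= /eq_rep|Px]; first by rewrite subr0.
by apply: proj_eq; rewrite subr0.
Qed.

End Submodule.

Section Kernel.
Context {R : pzRingType} {U V : lmodType R}.
Variable f : {linear U -> V}.

Definition kersm : submod U.
Proof.
exists (fun x => f x = 0); first exact: linear0.
by move=> a x y fx fy; rewrite linearP fx fy scaler0 addr0.
Defined.

Definition imsm : submod V.
Proof.
exists (fun y => exists x, f x = y); first by exists 0; rewrite linear0.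
by move=> a _ _ [x <-] [y <-]; exists (a *: x + y); rewrite linearP.
Defined.

End Kernel.

(** * Short exact sequences and the vanishing of Ext^1 *)

Section ShortExact.
Context {R : pzRingType}.
Implicit Types A B C E K M P Q X Y : lmodType R.

Definition ses A B C (f : {linear A -> B}) (g : {linear B -> C}) : Prop :=
  [/\ injective f, exact_at f g & forall z, exists y, g y = z].

Lemma ses_comp0 A B C (f : {linear A -> B}) (g : {linear B -> C}) :
  ses f g -> forall x, g (f x) = 0.
Proof. by case=> _ ex _ x; apply/ex; exists x. Qed.

Lemma injective_ker0 A B (f : {linear A -> B}) :
  (forall x, f x = 0 -> x = 0) -> injective f.
Proof.
move=> H x y E; apply/eqP; rewrite -subr_eq0; apply/eqP/H.
by rewrite linearB E subrr.
Qed.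

Lemma ses_ker A B (f : {linear A -> B}) : (forall y, exists x, f x = y) ->
  ses (sub_incl (kersm f)) f.
Proof.
move=> fs; split=> [|y|//]; first exact: sub_incl_inj.
split=> [fy|[x <-]]; last exact: (sub_valP x).
by exists (sub_intro (P := kersm f) fy).
Qed.

Lemma ses_quot A B (f : {linear A -> B}) : injective f ->
  ses f (quot_proj (imsm f)).
Proof.
move=> fi; split=> [//|y|]; first exact: quot_proj_eq0.
exact: quot_proj_surj.
Qed.

(** Universal property of a cokernel. The map is [h] after a set-theoretic section of [g]; it is
    linear because [h] is constant on the fibres of [g]. *)
Lemma descend B C (g : {linear B -> C}) X (h : {linear B -> X}) :
  (forall z, exists y, g y = z) -> (forall y, g y = 0 -> h y = 0) ->
  exists k : {linear C -> X}, forall y, k (g y) = h y.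
Proof.
move=> /fun_choice[s sK] h0.
have hE x y : g x = g y -> h x = h y.
  move=> E; apply/eqP; rewrite -subr_eq0 -linearB; apply/eqP/h0.
  by rewrite linearB E subrr.
have lin : linear (h \o s).
  by move=> a x y /=; rewrite -linearP; apply: hE; rewrite linearP !sK.
by exists (mklin lin) => y; apply: hE; rewrite sK.
Qed.

Lemma corestrict A B (f : {linear A -> B}) X (h : {linear X -> B}) :
  injective f -> (forall y, exists x, f x = h y) ->
  exists k : {linear X -> A}, forall y, f (k y) = h y.
Proof.
move=> fi /fun_choice[s sK].
have lin : linear s by move=> a x y; apply: fi; rewrite linearP !sK linearP.
by exists (mklin lin) => y.
Qed.

(* Ext^1(M, X) = 0, tested on all sequences 0 -> A -> B -> M -> 0. *)
Definition ext1_vanish M X : Prop := forall A B (i : {linear A -> B})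
  (p : {linear B -> M}), ses i p -> forall phi : {linear A -> X},
  exists psi : {linear B -> X}, forall a, psi (i a) = phi a.

(** A single projective presentation is enough to test Ext^1, because every extension of [M] by [A]
    is the pushout of this one along a map [K -> A]. *)
Lemma ext1_proj_pres K P M (i : {linear K -> P}) (p : {linear P -> M}) X :
  ses i p -> is_projective P ->
  (forall phi : {linear K -> X}, exists psi : {linear P -> X},
    forall a, psi (i a) = phi a) -> ext1_vanish M X.
Proof.
move=> [ii iex ip] Pp H A B j q [jj jex jq] phi.
have [u uE] := Pp _ _ q p jq.
have [v vE] : exists v : {linear K -> A}, forall y, j (v y) = (u \o i) y.
  by apply: corestrict => // y; apply/jex; rewrite /= uE; apply/iex; exists y.
have [w wE] := H (phi \o v).
have lin : linear (fun x : A * P => j x.1 + u x.2).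
  by move=> a x y /=; rewrite !linearP addrACA -scalerDr.
have lin' : linear (fun x : A * P => phi x.1 + w x.2).
  by move=> a x y /=; rewrite !linearP addrACA -scalerDr.
(* [B] is the pushout of [A] and [P] over [K]: the map [A * P -> B] is onto and its kernel consists
   of the pairs [(- v k, i k)]. *)
have [||k kE] := @descend _ _ (mklin lin) _ (mklin lin').
- move=> b; have [y yE] := ip (q b).
  have /jex[a aE] : q (b - u y) = 0 by rewrite linearB uE yE subrr.
  by exists (a, y); rewrite /= aE subrK.
- move=> [a y] /= E.
  have : p y = 0.
    have /(congr1 q) := E; rewrite linearD linear0 uE.
    by have -> : q (j a) = 0 by [apply/jex; exists a]; rewrite add0r.
  case/iex=> k kE; rewrite -kE wE /= -linearD.
  suff -> : a + v k = 0 by rewrite linear0.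
  by apply: jj; rewrite linearD vE /= kE linear0.
by exists k => a; have := kE (a, 0); rewrite /= !linear0 !addr0.
Qed.

(** Extending [phi] to [B] with values in [E] induces a map [M -> Y]; subtracting a lift of that map
    to [E] brings the extension back into [X]. *)
Lemma ext1_inj_pres X E Y (i : {linear X -> E}) (p : {linear E -> Y}) M :
  ses i p -> is_injective E ->
  (forall phi : {linear M -> Y}, exists psi : {linear M -> E},
    forall a, p (psi a) = phi a) -> ext1_vanish M X.
Proof.
move=> [ii iex ip] Ei H A B j q [jj jex jq] phi.
have [u uE] := Ei _ _ j (i \o phi) jj.
have [|v vE] := descend (h := p \o u) jq.
  by move=> y /jex[a <-] /=; rewrite uE; apply/iex; exists (phi a).
have [w wE] := H v.
have [|k kE] := @corestrict _ _ i _ (u \- (w \o q)) ii.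
  by move=> y; apply/iex; rewrite /= linearB wE vE subrr.
exists k => a; apply: ii; rewrite kE /= uE.
have -> : q (j a) = 0 by apply/jex; exists a.
by rewrite linear0 subr0.
Qed.

Lemma ext1_projective M X : is_projective M -> ext1_vanish M X.
Proof.
move=> Mp A B j q [jj jex jq] phi.
have [s sE] := Mp _ _ q idfun jq.
have [|k kE] := @corestrict _ _ j _ (idfun \- (s \o q)) jj.
  by move=> y; apply/jex; rewrite /= linearB sE subrr.
exists (phi \o k) => a /=; congr (phi _); apply: jj; rewrite kE /=.
have -> : q (j a) = 0 by apply/jex; exists a.
by rewrite linear0 subr0.
Qed.

Lemma ext1_injective M X : is_injective X -> ext1_vanish M X.
Proof. by move=> Xi A B j q [jj _ _] phi; apply: Xi. Qed.

Lemma injective_ext1 X : (forall M, ext1_vanish M X) -> is_injective X.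
Proof. by move=> H A B i f ii; have := H _ _ _ _ _ (ses_quot ii) f. Qed.

Lemma retract_projective P Q (s : {linear P -> Q}) (r : {linear Q -> P}) :
  (forall x, r (s x) = x) -> is_projective Q -> is_projective P.
Proof.
move=> rs Qp A B g f gs; have [h hE] := Qp _ _ g (f \o r) gs.
by exists (h \o s) => x /=; rewrite hE /= rs.
Qed.

Lemma retract_injective P Q (s : {linear P -> Q}) (r : {linear Q -> P}) :
  (forall x, r (s x) = x) -> is_injective Q -> is_injective P.
Proof.
move=> rs Qi A B i f ii; have [h hE] := Qi _ _ i (s \o f) ii.
by exists (r \o h) => x /=; rewrite hE /= rs.
Qed.

Lemma ses_section A B C (f : {linear A -> B}) (g : {linear B -> C}) :
  ses f g -> ext1_vanish C A -> exists2 r : {linear B -> A}, (forall x, r (f x) = x) &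
    exists s : {linear C -> B}, forall x, g (s x) = x.
Proof.
move=> fg /(_ _ _ _ _ fg idfun)[r rE]; exists r => //.
case: fg => fi fex gs.
have [|s sE] := descend (h := idfun \- (f \o r)) gs.
  by move=> y /fex[x <-] /=; rewrite rE /= subrr.
exists s => x; have [y <-] := gs x; rewrite sE /= linearB.
have -> : g (f (r y)) = 0 by apply/fex; exists (r y).
by rewrite subr0.
Qed.

Lemma prod_projective P Q :
  is_projective P -> is_projective Q -> is_projective (P * Q)%type.
Proof.
move=> Pp Qp A B g f gs.
have lin1 : linear (fun x : P => (x, 0 : Q)).
  by move=> a x y; congr pair; rewrite /= scaler0 addr0.
have lin2 : linear (fun x : Q => (0 : P, x)).
  by move=> a x y; congr pair; rewrite /= scaler0 addr0.
have [h1 h1E] := Pp _ _ g (f \o mklin lin1) gs.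
have [h2 h2E] := Qp _ _ g (f \o mklin lin2) gs.
have lin : linear (fun x : P * Q => h1 x.1 + h2 x.2).
  by move=> a x y /=; rewrite !linearP addrACA -scalerDr.
exists (mklin lin) => -[x y] /=.
by rewrite linearD h1E h2E /= -linearD; congr (f (_, _)); rewrite /= ?addr0 ?add0r.
Qed.

End ShortExact.


(** * Characters of abelian groups *)

(** Zorn's lemma among the sets containing [G0]. Unions are only required for nonempty chains, the
    empty chain being bounded by [G0]. *)
Lemma Zorn_above (U : Type) (P : set U -> Prop) (G0 : set U) : P G0 ->
  (forall F : set (set U), (F !=set0)%classic -> (F `<=` P)%classic ->
     total_on F subset -> P (\bigcup_(X in F) X)%classic) ->
  exists G, [/\ P G, (G0 `<=` G)%classic &
    forall G', P G' -> (G `<=` G')%classic -> (G' `<=` G)%classic].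
Proof.
move=> PG0 union; pose T := {G : set U | P G /\ (G0 `<=` G)%classic}.
pose t0 : T := exist _ G0 (conj PG0 (fun x => id)).
have [|r s t /asboolP rs /asboolP st|A totA|[G [PG G0G]] maxG] :=
    @ZL_preorder T t0 (fun s t => `[< (sval s `<=` sval t)%classic >]).
- by move=> t; apply/asboolP.
- by apply/asboolP => x /rs/st.
- have [[s0 As0]|A0] := pselect (exists s, A s); last first.
    by exists t0 => s As; case: A0; exists s.
  pose F : set (set U) := [set sval s | s in A]%classic.
  have PU : P (\bigcup_(X in F) X)%classic.
    apply: union => [|_ [s _ <-]|_ _ [s As <-] [t At <-]].
    - by exists (sval s0), s0.
    - by case: (svalP s).
    - by case: (totA _ _ As At) => /asboolP; [left|right].
  have G0U : (G0 `<=` \bigcup_(X in F) X)%classic.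
    move=> x G0x; exists (sval s0); first by exists s0.
    by case: (svalP s0) => _; apply.
  exists (exist _ (\bigcup_(X in F) X)%classic (conj PU G0U) : T) => s As.
  apply/asboolP => x sx.
  by exists (sval s) => //; exists s.
exists G; split=> // G' PG' GG'; apply/asboolP.
apply: (maxG (exist _ G' (conj PG' (fun x h => GG' x (G0G x h))) : T)).
exact/asboolP.
Qed.

Section Subgroups.
Context {V : zmodType}.
Variable A : V -> Prop.

Definition subgroup : Prop := A 0 /\ forall x y, A x -> A y -> A (x - y).

Hypothesis gA : subgroup.

Lemma subgroupN x : A x -> A (- x).
Proof. by case: gA => A0 AB Ax; rewrite -[- x]add0r; apply: AB. Qed.

Lemma subgroupD x y : A x -> A y -> A (x + y).
Proof.
by move=> Ax Ay; rewrite -[y]opprK; case: gA => _; apply => //; apply: subgroupN.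
Qed.

Lemma subgroupMz x n : A x -> A (x *~ n).
Proof.
move=> Ax; have AM m : A (x *+ m).
  elim: m => [|m IH]; first by case: gA.
  by rewrite mulrS; apply: subgroupD.
by case: n => n; [apply: AM | apply: subgroupN; apply: AM].
Qed.

(** [k] is the order of [x] modulo [A], with 0 standing for infinite order: the generator of an
    ideal of the integers. *)
Lemma subgroup_order x : exists k : nat, forall n : int,
  A (x *~ n) <-> (k %| n)%Z.
Proof.
have [ex|nex] := pselect (exists k, `[< (0 < k)%N /\ A (x *+ k) >]); last first.
  exists 0%N => n; split=> [An|]; last first.
    by rewrite dvd0z => /eqP ->; case: gA.
  rewrite dvd0z; case: n An => [[|n]|n] // An; case: nex; exists n.+1.
    exact/asboolP.
  apply/asboolP; split=> //; rewrite -[_ *+ _]opprK; exact: subgroupN.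
case: (ex_minnP ex) => k /asboolP[k0 Ak] kmin; exists k => n.
split=> [An|/dvdzP[q ->]]; last first.
  by rewrite mulrC mulrzA; apply: subgroupMz.
have Ar : A (x *~ (n %% k)%Z).
  have -> : (n %% k)%Z = n - k%:Z * (n %/ k)%Z.
    by rewrite [X in X - _](divz_eq n k) mulrC addrC addKr.
  rewrite mulrzBr mulrzA; case: gA => _; apply=> //; exact: subgroupMz.
have r0 : 0 <= (n %% k)%Z by apply: modz_ge0; case: (k) k0.
have rk : (n %% k)%Z < k by apply: ltz_pmod.
apply/dvdz_mod0P; case: (n %% k)%Z r0 rk Ar => [[|r]|r] // _ rk Ar.
have /kmin : `[< (0 < r.+1)%N /\ A (x *+ r.+1) >] by apply/asboolP.
by rewrite leqNgt => /negP[].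
Qed.

End Subgroups.

(* The multiplicative group of [algC], written additively: a divisible group
   with torsion of every order, used in the role of Q/Z. *)
Definition circ : Type := {x : algC | x != 0}.
HB.instance Definition _ := Choice.on circ.

Section Circ.

Let one : circ := exist _ 1 (oner_neq0 _).
Let inv (x : circ) : circ :=
  exist _ (val x)^-1 (etrans (f_equal negb (invr_eq0 _)) (valP x)).
Let mul (x y : circ) : circ := exist _ (val x * val y) (mulf_neq0 (valP x) (valP y)).

Fact circ_mulA : associative mul.
Proof. by move=> x y z; apply: val_inj; rewrite /= mulrA. Qed.
Fact circ_mulC : commutative mul.
Proof. by move=> x y; apply: val_inj; rewrite /= mulrC. Qed.
Fact circ_mul1 : left_id one mul.
Proof. by move=> x; apply: val_inj; rewrite /= mul1r. Qed.
Fact circ_mulV : left_inverse one inv mul.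
Proof. by move=> x; apply: val_inj; rewrite /= mulVf ?(valP x). Qed.
HB.instance Definition _ := GRing.isZmodule.Build circ
  circ_mulA circ_mulC circ_mul1 circ_mulV.

Lemma circ_valM (x : circ) n : val (x *+ n) = val x ^+ n.
Proof. by elim: n => // n IH; rewrite mulrS exprS -IH. Qed.

Lemma circ_divisible (d : circ) k : (0 < k)%N -> exists d' : circ, d' *+ k = d.
Proof.
move=> k0; have nz : @Num.Theory.nthroot algC k (val d) != 0.
  by rewrite Num.Theory.rootC_eq0 // (valP d).
exists (exist (fun x : algC => x != 0) _ nz : circ); apply: val_inj.
by rewrite circ_valM; apply: Num.Theory.rootCK.
Qed.

Lemma circ_torsion k : k != 1%N -> exists2 d : circ, d != 0 & d *+ k = 0.
Proof.
case: k => [|[//|k]] _.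
  (* The multiple by 0 kills everything, so any complex number other than 0 and 1 serves; 2 is
     taken. *)
  have n2 : (2%:R : algC) != 0 by rewrite Num.Theory.pnatr_eq0.
  exists (exist (fun x : algC => x != 0) _ n2 : circ) => //.
  apply/eqP => /(congr1 val)/= /eqP.
  by rewrite Num.Theory.pnatr_eq1.
have [z zp] := C_prim_root_exists (ltn0Sn k.+1).
have z1 := prim_expr_order zp.
have nz : z != 0.
  by apply/eqP => z0; move/eqP: z1; rewrite z0 expr0n eq_sym oner_eq0.
exists (exist (fun x : algC => x != 0) _ nz : circ); last first.
  by apply: val_inj; rewrite circ_valM.
apply/eqP => /(congr1 val)/= E.
by have := eq_prim_root_expr zp 1 0; rewrite E !expr1n eqxx => /esym.
Qed.

End Circ.

(** Baer's argument for divisible groups. Partial homomorphisms are encoded by their graphs, the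
    single-valued subgroups of [B * circ], so that Zorn's lemma applies to inclusion; a maximal
    graph is total. *)
Lemma additive_extension (B : zmodType) (G0 : set (B * circ)) :
  subgroup G0 -> (forall u, G0 u -> u.1 = 0 -> u.2 = 0) ->
  exists h : {additive B -> circ}, forall u, G0 u -> h u.1 = u.2.
Proof.
move=> gG0 fG0.
have [||G [[gG fG] G0G maxG]] := @Zorn_above _ (fun G : set (B * circ) =>
    subgroup G /\ forall u, G u -> u.1 = 0 -> u.2 = 0) G0.
- by [].
- move=> F [X0 FX0] FP totF; split; last first.
    by move=> u [X FX Xu]; case: (FP _ FX) => _; apply.
  split; first by exists X0 => //; case: (FP _ FX0) => -[].
  move=> u v [X FX Xu] [Y FY Yv].
  case: (totF _ _ FX FY) => XY; [exists Y => // | exists X => //].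
    by case: (FP _ FY) => -[_ YB] _; apply: YB => //; apply: XY.
  by case: (FP _ FX) => -[_ XB] _; apply: XB => //; apply: XY.
have tot x : exists d, G (x, d).
  pose A y := exists d, G (y, d).
  have gA : subgroup A.
    split; first by exists 0; case: gG.
    by move=> y z [d Gd] [e Ge]; exists (d - e); case: gG => _ /(_ _ _ Gd Ge).
  have [k kE] := subgroup_order gA x.
  have [d Gd] : exists d, G ((x, d) *~ k).
    have [e Ge] : A (x *~ k) by apply/kE.
    (* If no positive multiple of [x] is in the domain, the value at [x] is unconstrained and 0 is
       taken; otherwise it is a [k]-th part of a value at [k x]. *)
    have [k0|k0] := posnP k.
      by exists 0; rewrite k0; case: gG.
    have [d dE] := circ_divisible e k0; exists d; move: Ge; rewrite -dE.
    congr G; rewrite -!pmulrn; apply: injective_projections => /=.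
      by rewrite (raddfMn fst).
    by rewrite (raddfMn snd).
  pose v := (x, d).
  pose G' := [set w | exists u n, G u /\ w = u + v *~ n]%classic.
  have G'v : G' v by exists 0, 1; split; [case: gG | rewrite add0r].
  suff /maxG : subgroup G' /\ forall u, G' u -> u.1 = 0 -> u.2 = 0.
    move=> /(_ _ v G'v) Gv; exists d; apply: Gv => u Gu.
    by exists u, 0; rewrite mulr0z addr0.
  split.
    split; first by exists 0, 0; split; [case: gG | rewrite mulr0z addr0].
    move=> _ _ [u [n [Gu ->]]] [w [m [Gw ->]]].
    exists (u - w), (n - m); split; first by case: gG => _; apply.
    by rewrite opprD mulrzBr addrACA.
  move=> _ [u [n [Gu ->]]] w0.
  (* The enlarged graph stays single-valued: over 0 the multiple [n x] lies in the old domain, so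
     [k] divides [n] and [v *~ n] is already in [G]. *)
  have /kE/dvdzP[q qE] : A (x *~ n).
    have -> : x *~ n = - u.1.
      by apply/eqP; rewrite -addr_eq0 addrC -[x](erefl : v.1 = x) -(raddfMz fst) -w0.
    exists (- u.2); rewrite -[(_, _)]/(- (u.1, u.2)) -surjective_pairing.
    exact: subgroupN.
  apply: fG w0; apply: subgroupD => //.
  by rewrite qE mulrC mulrzA; apply: subgroupMz.
have [h hE] := fun_choice tot.
have hG u : G u -> h u.1 = u.2.
  move=> Gu; apply/eqP; rewrite -subr_eq0; apply/eqP.
  apply: (fG ((u.1, h u.1) - u)); last by rewrite /= subrr.
  by case: gG => _; apply.
have addh : zmod_morphism h.
  move=> x y; apply: (hG ((x, h x) - (y, h y))).
  by case: gG => _; apply.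
by exists (mkadd addh) => u /G0G /hG.
Qed.

Lemma additive_extend (A B : zmodType) (i : {additive A -> B})
    (f : {additive A -> circ}) : injective i ->
  exists h : {additive B -> circ}, forall a, h (i a) = f a.
Proof.
move=> ii; have [||h hE] :=
    @additive_extension B [set u | exists a, u = (i a, f a)]%classic.
- split; first by exists 0; rewrite !raddf0.
  by move=> _ _ [a ->] [b ->]; exists (a - b); rewrite !raddfB.
- move=> _ [a ->] /= ia0; have -> : a = 0 by apply: ii; rewrite raddf0.
  by rewrite raddf0.
by exists h => a; apply: (hE (i a, f a)); exists a.
Qed.

(** The order [k] of [x] modulo [A] is not 1, so [circ] has a nonzero [d] killed by [k]. Sending [A]
    to 0 and [x] to [d] is then consistent, and extends to [B]. *)
Lemma character_separation (B : zmodType) (A : B -> Prop) x :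
  subgroup A -> ~ A x ->
  exists h : {additive B -> circ}, (forall a, A a -> h a = 0) /\ h x <> 0.
Proof.
move=> gA nAx; have [k kE] := subgroup_order gA x.
have k1 : k != 1%N.
  by apply/eqP => k1; apply: nAx; rewrite -[x]mulr1z; apply/kE; rewrite k1.
have [d /eqP d0 dk] := circ_torsion k1.
have [||h hE] := @additive_extension B
    [set u | exists a n, A a /\ u = (a + x *~ n, d *~ n)]%classic.
- split; first by exists 0, 0; rewrite !mulr0z addr0; split=> //; case: gA.
  move=> _ _ [a [n [Aa ->]]] [b [m [Ab ->]]]; exists (a - b), (n - m).
  split; first by case: gA => _; apply.
  by rewrite !mulrzBr addrACA -opprD.
- move=> _ [a [n [Aa ->]]] /= /eqP; rewrite addrC addr_eq0 => /eqP xn.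
  have /kE/dvdzP[q ->] : A (x *~ n) by rewrite xn; apply: subgroupN.
  by rewrite mulrC mulrzA -pmulrn dk mul0rz.
exists h; split=> [a Aa|].
  by apply: (hE (a, 0)); exists a, 0; rewrite !mulr0z addr0.
rewrite (hE (x, d)) //; exists 0, 1; rewrite !mulr1z add0r; split=> //.
by case: gA.
Qed.


(** * Free modules and character modules *)

Section Free.
Context {R : pzRingType} {X : choiceType}.

Definition finsuppsm : submod (X -> R^o).
Proof.
exists (fun v => exists l : seq X, forall x, x \notin l -> v x = 0).
  by exists [::].
move=> a v w [l lE] [m mE]; exists (l ++ m) => x.
rewrite mem_cat negb_or => /andP[xl xm].
by rewrite -[LHS]/(a * v x + w x) lE // mE // mulr0 addr0.
Defined.

Definition freemod := sub finsuppsm.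
HB.instance Definition _ := GRing.Lmodule.on freemod.

Definition coef (x : X) (v : freemod) : R := val v x.

Fact coef_linear x : linear (coef x : freemod -> R^o).
Proof. by []. Qed.
HB.instance Definition _ x :=
  GRing.isLinear.Build R freemod R^o _ (coef x) (coef_linear x).

Lemma coefZ x a v : coef x (a *: v) = a * coef x v. Proof. by []. Qed.
Lemma coefD x v w : coef x (v + w) = coef x v + coef x w. Proof. by []. Qed.
Lemma coefB x v w : coef x (v - w) = coef x v - coef x w. Proof. by []. Qed.

(** A chosen finite list containing the support; some of its coefficients may be zero. *)
Definition fsupp (v : freemod) : seq X := undup (projT1 (cid (sub_valP v))).

Lemma fsupp_uniq v : uniq (fsupp v).
Proof. exact: undup_uniq. Qed.

Lemma coef_fsupp v x : x \notin fsupp v -> coef x v = 0.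
Proof. by rewrite mem_undup; case: cid => /= l lE /lE. Qed.

Lemma freeP (v w : freemod) : (forall x, coef x v = coef x w) -> v = w.
Proof. by move=> H; apply: val_inj; apply/funext. Qed.

Fact fbasis_subproof (x : X) : finsuppsm (fun y => if y == x then 1 else 0).
Proof. by exists [:: x] => y; rewrite inE => /negPf ->. Qed.
Definition fbasis x : freemod := sub_intro (fbasis_subproof x).

Lemma coef_fbasis x y : coef y (fbasis x) = if y == x then 1 else 0.
Proof. by []. Qed.

Lemma fsum_coef v (l : seq X) : uniq l ->
  (forall x, x \notin l -> coef x v = 0) ->
  v = \sum_(x <- l) coef x v *: fbasis x.
Proof.
move=> ul lE; apply: freeP => y; rewrite linear_sum /=.
have [yl|yl] := boolP (y \in l).
  rewrite (bigD1_seq y) //= big1 ?addr0 => [|x xy]; rewrite coefZ coef_fbasis.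
    by rewrite eqxx mulr1.
  by rewrite eq_sym (negPf xy) mulr0.
rewrite lE // big_seq big1 // => x xl; rewrite coefZ coef_fbasis.
by case: eqP => [E|_]; [rewrite -E (negPf yl) in xl | rewrite mulr0].
Qed.

Lemma free_decomp v : v = \sum_(x <- fsupp v) coef x v *: fbasis x.
Proof. by apply: fsum_coef; [exact: fsupp_uniq | exact: coef_fsupp]. Qed.

Lemma free_addext (V : zmodType) (f g : {additive freemod -> V}) :
  (forall r x, f (r *: fbasis x) = g (r *: fbasis x)) -> f =1 g.
Proof.
by move=> H v; rewrite (free_decomp v) !raddf_sum; apply: eq_bigr => x _.
Qed.

Lemma free_ext (M : lmodType R) (f g : {linear freemod -> M}) :
  (forall x, f (fbasis x) = g (fbasis x)) -> f =1 g.
Proof.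
move=> H; apply: (free_addext (f := f) (g := g)) => r x.
by rewrite [LHS](linearZZ f) [RHS](linearZZ g) H.
Qed.

Section Lift.
Context {V : zmodType}.
Variables (k : X -> R -> V) (addk : forall x, zmod_morphism (k x)).

Let k0 x : k x 0 = 0.
Proof. by rewrite -[0]subr0 addk subrr. Qed.

(** Each basis element contributes an arbitrary additive map on [R], not only a multiple of a
    vector: characters of free modules are additive maps of this kind. *)
Definition flift_fun (v : freemod) : V := \sum_(x <- fsupp v) k x (coef x v).

(** Once the terms with zero coefficient are dropped, the two index lists agree up to
    permutation. *)
Let flift_on v l : uniq l -> (forall x, x \notin l -> coef x v = 0) ->
  flift_fun v = \sum_(x <- l) k x (coef x v).
Proof.
move=> ul lE; pose p x := coef x v != 0.
have E m : uniq m -> (forall x, x \notin m -> coef x v = 0) ->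
    \sum_(x <- m) k x (coef x v) = \sum_(x <- m | p x) k x (coef x v).
  move=> um mE; rewrite (bigID p) /= addrC big1 ?add0r // => x /negPn/eqP ->.
  exact: k0.
rewrite /flift_fun (E (fsupp v) (fsupp_uniq v)) ?(E l) //; last exact: coef_fsupp.
rewrite -[LHS]big_filter -[RHS]big_filter; apply: perm_big; apply: uniq_perm.
- exact/filter_uniq/fsupp_uniq.
- exact: filter_uniq.
move=> x; rewrite !mem_filter; case: (boolP (p x)) => //= px.
have mem (m : seq X) : (forall y, y \notin m -> coef y v = 0) -> x \in m.
  by move=> mE; apply: contraR px => /mE/eqP E0; rewrite /p E0.
by rewrite !mem //; exact: coef_fsupp.
Qed.

Fact flift_additive : zmod_morphism flift_fun.
Proof.
move=> v w; pose l := undup (fsupp v ++ fsupp w).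
have ul : uniq l := undup_uniq _.
have lE x : x \notin l -> coef x v = 0 /\ coef x w = 0.
  rewrite mem_undup mem_cat negb_or => /andP[xv xw].
  by rewrite !coef_fsupp.
rewrite !(@flift_on _ l) // => [|x /lE[]|x /lE[]|x /lE[]] //; last first.
  by move=> cv cw; rewrite coefB cv cw subr0.
by rewrite -sumrB; apply: eq_bigr => x _; rewrite coefB addk.
Qed.

Definition flift : {additive freemod -> V} := mkadd flift_additive.

Lemma fliftE r x : flift (r *: fbasis x) = k x r.
Proof.
rewrite /flift /= (@flift_on _ [:: x]) ?big_seq1 //.
  by rewrite coefZ coef_fbasis eqxx; congr k; exact: mulr1.
move=> y; rewrite inE coefZ coef_fbasis => /negPf ->; exact: mulr0.
Qed.

End Lift.

Section LinearLift.
Context {M : lmodType R}.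
Variable m : X -> M.

Let k x (r : R) : M := r *: m x.
Let addk x : zmod_morphism (k x).
Proof. by move=> a b; rewrite /k scalerBl. Qed.

Fact flin_linear : linear (flift addk).
Proof.
move=> a u v; rewrite raddfD /=; congr (_ + _).
have addL : zmod_morphism (fun w => flift addk (a *: w)).
  by move=> x y; rewrite scalerBr raddfB.
have addR : zmod_morphism (fun w => a *: flift addk w).
  by move=> x y; rewrite raddfB scalerBr.
apply: (free_addext (f := mkadd addL) (g := mkadd addR)) => r x.
rewrite -[LHS]/(flift addk _) -[RHS]/(a *: flift addk _).
by rewrite scalerA !fliftE /k scalerA.
Qed.

Definition flin : {linear freemod -> M} := mklin flin_linear.

Lemma flinE x : flin (fbasis x) = m x.
Proof.
by rewrite -[fbasis x]scale1r -[LHS]/(flift addk _) fliftE /k scale1r.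
Qed.

End LinearLift.

Lemma freemod_projective : is_projective freemod.
Proof.
move=> A B g f gs.
have [m mE] := fun_choice (fun x => gs (f (fbasis x))).
exists (flin m); apply: (free_ext (f := g \o flin m) (g := f)) => x.
by rewrite -[LHS]/(g (flin m (fbasis x))) flinE mE.
Qed.

End Free.
Arguments freemod R X : clear implicits.

(** * Free covers, syzygies and dimension shifting *)

Section Covers.
Context {R : pzRingType}.
Implicit Types A B C E K M P Q X Y : lmodType R.

Definition fcover M : {linear freemod R M -> M} := flin (fun x : M => x).

Lemma fcoverE M (x : M) : fcover M (fbasis x) = x.
Proof. exact: flinE. Qed.

Lemma fcover_surj M (x : M) : exists v, fcover M v = x.
Proof. by exists (fbasis x); apply: fcoverE. Qed.

Lemma projective_section P : is_projective P ->
  exists s : {linear P -> freemod R P}, forall x, fcover P (s x) = x.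
Proof. by move=> Pp; apply: (Pp _ _ (fcover P) idfun); apply: fcover_surj. Qed.

Definition Omega M : lmodType R := sub (kersm (fcover M)).

Lemma ses_Omega M : ses (sub_incl (kersm (fcover M))) (fcover M).
Proof. by apply: ses_ker; apply: fcover_surj. Qed.

(** The cokernel of Hom(K, E) -> Hom(K, Y) embeds in Ext^1(K, X). Concretely, [phi] lifts on the
    free cover of [K]; on the syzygy the lift takes values in [X], and extending that map to the
    cover gives the correction. *)
Lemma lift_ext1 K X E Y (i : {linear X -> E}) (p : {linear E -> Y}) :
  ses i p -> ext1_vanish K X -> forall phi : {linear K -> Y},
  exists psi : {linear K -> E}, forall x, p (psi x) = phi x.
Proof.
move=> [ii iex ip] KX phi; have sO := ses_Omega K; have [jj jex jp] := sO.
have [u uE] := @freemod_projective R K _ _ p (phi \o fcover K) ip.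
have [|v vE] := @corestrict _ _ _ i _ (u \o sub_incl (kersm (fcover K))) ii.
  move=> y; apply/iex.
  rewrite -[LHS]/(p (u (sub_incl _ y))) uE -[LHS]/(phi (fcover K (sub_incl _ y))).
  by rewrite (ses_comp0 sO) linear0.
have [w wE] := KX _ _ _ _ sO v.
have [|s sE] := descend (h := u \- (i \o w)) jp.
  move=> y /jex[x <-]; rewrite -[LHS]/(u _ - i (w (sub_incl _ x))) wE vE.
  exact: subrr.
exists s => x; have [y <-] := jp x; rewrite sE -[LHS]/(p (u y - i (w y))) linearB uE.
have -> : p (i (w y)) = 0 by apply/iex; exists (w y).
by rewrite subr0.
Qed.

Lemma projective_ext1 P : (forall X, ext1_vanish P X) -> is_projective P.
Proof. by move=> H A B g f gs; apply: (lift_ext1 (ses_ker gs) (H _)). Qed.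

(* Dimension shifting, Ext^1(K, X) = Ext^2(M, X) = Ext^1(M, Y). *)
Lemma ext1_shift K P M (i : {linear K -> P}) (p : {linear P -> M})
    X E Y (j : {linear X -> E}) (q : {linear E -> Y}) :
  ses i p -> is_projective P -> ses j q -> is_injective E ->
  ext1_vanish K X <-> ext1_vanish M Y.
Proof.
move=> ip Pp jq Ei; have [ii iex ps] := ip; have [jj jex qs] := jq; split=> H.
  apply: (ext1_proj_pres ip Pp) => g.
  have [h hE] := lift_ext1 jq H g.
  have [k kE] := Ei _ _ i h ii.
  by exists (q \o k) => a /=; rewrite kE hE.
apply: (ext1_inj_pres jq Ei) => g.
have [h hE] := H _ _ _ _ ip g.
have [k kE] := Pp _ _ q h qs.
by exists (k \o i) => a /=; rewrite kE hE.
Qed.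

End Covers.

(* [R^c^c] is not convertible to [R], so the passages from left to right modules
   and back are treated uniformly through an anti-isomorphism. *)
Record antiiso (R S : pzRingType) := AntiIso {
  aifun :> S -> R;
  aiinv : R -> S;
  aiD : {morph aifun : x y / x + y};
  ai1 : aifun 1 = 1;
  aiM : forall x y, aifun (x * y) = aifun y * aifun x;
  aiK : cancel aifun aiinv;
  aiVK : cancel aiinv aifun }.

Definition anti_c (R : pzRingType) : antiiso R R^c :=
  @AntiIso R R^c id id (fun _ _ => erefl) erefl (fun _ _ => erefl)
    (fun _ => erefl) (fun _ => erefl).

Definition c_anti (R : pzRingType) : antiiso R^c R :=
  @AntiIso R^c R id id (fun _ _ => erefl) erefl (fun _ _ => erefl)
    (fun _ => erefl) (fun _ => erefl).

(** The character module, with [circ] for Q/Z. Carrying [t] in the type determines the [S]-module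
    structure, in which [s] acts by precomposition with [t s]. *)
Definition character (R S : pzRingType) (t : antiiso R S) (M : lmodType R) :=
  {f : M -> circ | `[< zmod_morphism f >]}.

Section Characters.
Context {R S : pzRingType}.
Variables (t : antiiso R S) (M : lmodType R).

Local Notation chr := (character t M).
HB.instance Definition _ := Choice.on chr.

Definition mkchr (f : M -> circ) (addf : zmod_morphism f) : chr :=
  exist _ f (asboolT addf).

Fact chr_additive (c : chr) : zmod_morphism (val c).
Proof. exact: asboolW (valP c). Qed.

Definition chr_fun (c : chr) : {additive M -> circ} := mkadd (chr_additive c).
Coercion chr_fun : chr >-> GRing.Additive.type.

Lemma chrP (c d : chr) : (forall x, c x = d x) -> c = d.
Proof. by move=> H; apply: val_inj; apply/funext. Qed.

Let zero : chr.
Proof. by apply: (@mkchr (fun=> 0)) => x y; rewrite subr0. Defined.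
Let opp (c : chr) : chr.
Proof.
by apply: (@mkchr (fun x => - c x)) => x y; rewrite raddfB opprB opprK addrC.
Defined.
Let add (c d : chr) : chr.
Proof.
by apply: (@mkchr (fun x => c x + d x)) => x y; rewrite !raddfB opprD addrACA.
Defined.
Let scale (s : S) (c : chr) : chr.
Proof. by apply: (@mkchr (fun x => c (t s *: x))) => x y; rewrite scalerBr raddfB. Defined.

Fact chr_addA : associative add.
Proof. by move=> c d e; apply: chrP => x /=; rewrite addrA. Qed.
Fact chr_addC : commutative add.
Proof. by move=> c d; apply: chrP => x /=; rewrite addrC. Qed.
Fact chr_add0 : left_id zero add.
Proof. by move=> c; apply: chrP => x /=; rewrite add0r. Qed.
Fact chr_addN : left_inverse zero opp add.
Proof. by move=> c; apply: chrP => x /=; rewrite addNr. Qed.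
HB.instance Definition _ := GRing.isZmodule.Build chr
  chr_addA chr_addC chr_add0 chr_addN.

Fact chr_scaleA a b v : scale a (scale b v) = scale (a * b) v.
Proof. by apply: chrP => x; rewrite /= scalerA aiM. Qed.
Fact chr_scale1 : left_id 1 scale.
Proof. by move=> v; apply: chrP => x; rewrite /= ai1 scale1r. Qed.
Fact chr_scaleDr : right_distributive scale +%R.
Proof. by move=> a u v; apply: chrP. Qed.
Fact chr_scaleDl v : {morph scale^~ v : a b / a + b}.
Proof.
move=> a b; apply: chrP => x.
by rewrite -[RHS]/(v _ + v _) -[LHS]/(v _) aiD scalerDl raddfD.
Qed.
HB.instance Definition _ := GRing.Zmodule_isLmodule.Build S chr
  chr_scaleA chr_scale1 chr_scaleDr chr_scaleDl.

Lemma chrDE (c d : chr) x : (c + d : chr) x = c x + d x. Proof. by []. Qed.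
Lemma chrZE s (c : chr) x : (s *: c : chr) x = c (t s *: x). Proof. by []. Qed.

End Characters.

Section CharacterModules.
Context {R S : pzRingType}.
Variable t : antiiso R S.

Section Map.
Context {M N : lmodType R}.
Variable f : {linear M -> N}.

Let fm (c : character t N) : character t M.
Proof. by apply: (@mkchr _ _ _ _ (fun x => c (f x))) => x y; rewrite !raddfB. Defined.

Fact chr_map_linear : linear fm.
Proof.
move=> s c d; apply: chrP => x.
rewrite -[LHS]/((s *: c + d : character t N) (f x)) !chrDE !chrZE.
by rewrite -[RHS]/((c : character t N) (f _) + (d : character t N) (f _)) linearZZ.
Qed.

Definition chr_map : {linear character t N -> character t M} := mklin chr_map_linear.

Lemma chr_mapE (c : character t N) x :
  (chr_map c : character t M) x = c (f x).
Proof. by []. Qed.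
End Map.

Lemma chr_map_inj (M N : lmodType R) (f : {linear M -> N}) :
  (forall y, exists x, f x = y) -> injective (chr_map f).
Proof.
move=> fs c d E; apply: chrP => y; have [x <-] := fs y.
by rewrite -!chr_mapE E.
Qed.

(** The character functor is exact because [circ] is injective as an abelian group. *)
Lemma ses_chr (A B C : lmodType R) (f : {linear A -> B}) (g : {linear B -> C}) :
  ses f g -> ses (chr_map g) (chr_map f).
Proof.
move=> fg; have [fi fex gs] := fg; split; first exact: chr_map_inj.
- move=> c; split=> [c0|[d <-]]; last first.
    apply: chrP => x; rewrite !chr_mapE (ses_comp0 fg); exact: raddf0.
  have [s sK] := fun_choice gs.
  have cE x y : g x = g y -> chr_fun c x = chr_fun c y.
    move=> E; apply/eqP; rewrite -subr_eq0 -raddfB; apply/eqP.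
    have /fex[a <-] : g (x - y) = 0 by rewrite linearB E subrr.
    by rewrite -chr_mapE c0.
  have add : zmod_morphism (fun z => chr_fun c (s z)).
    by move=> x y; rewrite -raddfB; apply: cE; rewrite linearB !sK.
  by exists (mkchr t add); apply: chrP => x; rewrite chr_mapE; apply: cE; rewrite sK.
move=> c; have [h hE] := additive_extend (i := f) (chr_fun c) fi.
by exists (mkchr t (@raddfB _ _ h)); apply: chrP => x; apply: hE.
Qed.

(** By retraction it suffices to treat a free module. A linear map into its character module amounts
    to one additive map to [circ] per basis element, and each of these extends separately. *)
Lemma chr_projective (P : lmodType R) : is_projective P -> is_injective (character t P).
Proof.
move=> /projective_section[s sK].
suff Fi : is_injective (character t (freemod R P)).
  apply: (retract_injective (s := chr_map (fcover P)) (r := chr_map s)) Fi.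
  by move=> c; apply: chrP => x; rewrite !chr_mapE sK.
move=> A B i f ii.
have add1 x : zmod_morphism (fun a => chr_fun (f a) (fbasis x)).
  by move=> a b; rewrite raddfB.
have [beta betaE] := fun_choice
  (fun x => additive_extend (i := i) (mkadd (add1 x)) ii).
have tinvB r r' : aiinv t (r - r') = aiinv t r - aiinv t r'.
  have tB x y : t (x - y) = t x - t y.
    by apply: (addIr (t y)); rewrite -aiD !subrK.
  by apply: (can_inj (aiK t)); rewrite tB !aiVK.
pose k b x r := beta x (aiinv t r *: b).
have addk b x : zmod_morphism (k b x).
  by move=> r r'; rewrite /k tinvB scalerBl raddfB.
pose h b : character t (freemod R P) := mkchr t (@raddfB _ _ (flift (addk b))).
have hE b r x : h b (r *: fbasis x) = beta x (aiinv t r *: b) by exact: fliftE.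
have lin : linear h.
  move=> a b c; apply: chrP.
  apply: (free_addext (f := h (a *: b + c)) (g := (a *: h b + h c : character t _))) => r x.
  rewrite hE chrDE chrZE scalerA !hE scalerDr raddfD scalerA; congr (beta x (_ *: _) + _).
  by apply: (can_inj (aiK t)); rewrite aiM !aiVK.
exists (mklin lin) => a; apply: chrP.
apply: (free_addext (f := h (i a)) (g := chr_fun (f a))) => r x.
by rewrite hE -linearZZ betaE -[LHS]/(chr_fun (f _) (fbasis x)) linearZZ chrZE aiVK.
Qed.

End CharacterModules.


(** * Projective and injective dimension through Ext *)

Section Dimensions.
Context {R : pzRingType}.
Implicit Types A B C E F K M P Q X Y : lmodType R.

(** A functorial source of enough injectives: dualizing a free cover of the character module of [X]
    embeds the double character module, which contains [X] by evaluation. *)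
Definition icover X : lmodType R :=
  character (c_anti R) (freemod R^c (character (anti_c R) X)).

Lemma icover_injective X : is_injective (icover X).
Proof. by apply: chr_projective; apply: freemod_projective. Qed.

Section Embedding.
Variable X : lmodType R.

Fact icover_subproof (x : X) :
  zmod_morphism (fun v => chr_fun (fcover (character (anti_c R) X) v) x).
Proof. by move=> v w; rewrite linearB. Qed.

Fact icover_linear : linear (fun x => mkchr (c_anti R) (icover_subproof x)).
Proof.
move=> a x y; apply: chrP => v; rewrite chrDE chrZE.
rewrite -[LHS]/(chr_fun (fcover _ v) (a *: x + y)) raddfD; congr (_ + _).
by rewrite -[RHS]/(chr_fun (fcover _ ((a : R^c) *: v)) x) linearZZ chrZE.
Qed.

Definition icover_emb : {linear X -> icover X} := mklin icover_linear.

(** A character [c] separates a nonzero [x] from 0, and the image of [x] takes the value [c x] at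
    the basis element of [c]. *)
Lemma icover_emb_inj : injective icover_emb.
Proof.
apply: injective_ker0 => x Ex; apply: contrapT => x0.
have [||h [_ hx]] := @character_separation X (fun y => y = 0) x => //.
  by split=> // y z -> ->; rewrite subr0.
apply: hx; pose c := mkchr (anti_c R) (@raddfB _ _ h).
rewrite -[LHS]/(chr_fun c x) -[c]fcoverE.
by rewrite -[LHS]/(chr_fun (icover_emb x) (fbasis c)) Ex.
Qed.

End Embedding.

Definition Sigma X : lmodType R := quot (imsm (icover_emb X)).

Lemma ses_Sigma X : ses (icover_emb X) (quot_proj (imsm (icover_emb X))).
Proof. by apply: ses_quot; apply: icover_emb_inj. Qed.

Lemma ext1_Omega M X : ext1_vanish (Omega M) X <-> ext1_vanish M (Sigma X).
Proof.
exact: (ext1_shift (ses_Omega M) freemod_projective (ses_Sigma X) (@icover_injective X)).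
Qed.

Lemma ext1_iter n M X : ext1_vanish (iter n Omega M) X <-> ext1_vanish M (iter n Sigma X).
Proof.
elim: n X => [//|n IH] X; rewrite iterS iterSr -IH; exact: ext1_Omega.
Qed.

(** Here and in [id_le] the condition is Ext^{n+1}(M, X) = 0, with one variable fixed and the other
    arbitrary; this common form lets the two dimensions be compared. *)
Definition pd_le n M := forall X, ext1_vanish M (iter n Sigma X).
Definition id_le n X := forall M, ext1_vanish M (iter n Sigma X).

Lemma pd_le_Omega n M : pd_le n M <-> is_projective (iter n Omega M).
Proof.
split=> [H|H X]; first by apply: projective_ext1 => X; apply/ext1_iter.
by apply/ext1_iter; apply: ext1_projective.
Qed.

Lemma id_le_Sigma n X : id_le n X <-> is_injective (iter n Sigma X).
Proof.
split=> [|H M]; first exact: injective_ext1.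
exact: ext1_injective.
Qed.

Lemma pd_le_shift n K P M (i : {linear K -> P}) (p : {linear P -> M}) :
  ses i p -> is_projective P -> pd_le n K <-> pd_le n.+1 M.
Proof.
move=> ip Pp.
have E X := ext1_shift ip Pp (ses_Sigma (iter n Sigma X)) (@icover_injective _).
by split=> H X; [apply: (E X).1 (H X) | apply: (E X).2 (H X)].
Qed.

(** [Y] is an arbitrary cosyzygy while [Sigma] is a fixed one, so the shift is made on the other
    variable: Ext^1(Omega^{n+1} M, X) = Ext^1(Omega^n M, Y). *)
Lemma id_le_shift n X E Y (j : {linear X -> E}) (q : {linear E -> Y}) :
  ses j q -> is_injective E -> id_le n Y <-> id_le n.+1 X.
Proof.
move=> jq Ei.
have H M := ext1_shift (ses_Omega (iter n Omega M)) freemod_projective jq Ei.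
split=> D M.
  exact: (ext1_iter n.+1 M X).1 ((H M).2 ((ext1_iter n M Y).2 (D M))).
exact: (ext1_iter n M Y).1 ((H M).1 ((ext1_iter n.+1 M X).2 (D M))).
Qed.

Lemma pd_le_leq m n M : (m <= n)%N -> pd_le m M -> pd_le n M.
Proof.
move=> /subnK <-; elim: (n - m)%N => [//|k IH] /IH H X.
by rewrite addSn iterSr.
Qed.

Lemma id_le_leq m n X : (m <= n)%N -> id_le m X -> id_le n X.
Proof.
move=> /subnK <-; elim: (n - m)%N => [//|k IH] /IH H M.
by rewrite addSn iterS; apply: (ext1_Omega _ _).1 (H _).
Qed.

Lemma ext1_Sigma_injective X : ext1_vanish (Sigma X) X -> is_injective X.
Proof.
move=> /(ses_section (ses_Sigma X))[r rE _].
by apply: (retract_injective rE); apply: icover_injective.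
Qed.

Lemma ext1_Omega_projective M : ext1_vanish M (Omega M) -> is_projective M.
Proof.
move=> /(ses_section (ses_Omega M))[_ _ [s sE]].
by apply: (retract_projective sE); apply: freemod_projective.
Qed.

(* If n <= k and Sigma^{k+1} X is injective, it has projective dimension at most k,
   so Ext^1(Sigma^{k+1} X, Sigma^k X) = Ext^{k+1}(Sigma^{k+1} X, X) = 0 and
   Sigma^k X is injective. *)
Lemma id_le_bounded n k X : (forall I, is_injective I -> pd_le n I) ->
  id_le k X -> id_le n X.
Proof.
move=> In; elim: k => [|k IH] idX; first by apply: id_le_leq idX.
have [kn|nk] := leqP k.+1 n; first by apply: id_le_leq idX.
apply: IH; apply/id_le_Sigma; apply: ext1_Sigma_injective.
apply: (pd_le_leq (m := n)) => //; apply: In.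
by move/id_le_Sigma: idX.
Qed.

(** Dual to [id_le_bounded]: if n <= k and Omega^{k+1} M is projective, its injective dimension is
    at most k, so Ext^1(Omega^k M, Omega^{k+1} M) = Ext^{k+1}(M, Omega^{k+1} M) = 0 and Omega^k M is
    projective. *)
Lemma pd_le_bounded n k M : (forall P, is_projective P -> id_le n P) ->
  pd_le k M -> pd_le n M.
Proof.
move=> Pn; elim: k => [|k IH] pdM; first by apply: pd_le_leq pdM.
have [kn|nk] := leqP k.+1 n; first by apply: pd_le_leq pdM.
apply: IH; apply/pd_le_Omega; apply: ext1_Omega_projective.
apply: (ext1_iter k M _).2; apply: (id_le_leq (m := n)) => //; apply: Pn.
by move/pd_le_Omega: pdM.
Qed.

Lemma pd_le_cover_kernel n P B (p : {linear P -> B}) : is_projective P ->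
  (forall y, exists x, p x = y) -> pd_le n B -> pd_le n.-1 (sub (kersm p)).
Proof.
move=> Pp ps pdB; apply/(pd_le_shift _ (ses_ker ps) Pp).
by apply: pd_le_leq pdB; case: n.
Qed.

(** Lifting the cover of [C] to [B] turns the product of the free covers of [A] and [C] into a cover
    of [B], whose kernel is [B']. The outer terms are the fixed syzygies; of the middle one only the
    dimension matters. *)
Lemma horseshoe n A B C (f : {linear A -> B}) (g : {linear B -> C}) :
  ses f g -> pd_le n B -> exists B' (f' : {linear Omega A -> B'})
    (g' : {linear B' -> Omega C}), ses f' g' /\ pd_le n.-1 B'.
Proof.
move=> fg pdB; have [fi fex gs] := fg.
have [u uE] := @freemod_projective R C _ _ g (fcover C) gs.
have lin : linear (fun x : freemod R A * freemod R C => f (fcover A x.1) + u x.2).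
  move=> a x y.
  rewrite -[LHS]/(f (fcover A (a *: x.1 + y.1)) + u (a *: x.2 + y.2)).
  by rewrite !linearP addrACA -scalerDr.
pose p := mklin lin.
have pE x : p x = f (fcover A x.1) + u x.2 by [].
have ps y : exists x, p x = y.
  have [c cE] := fcover_surj (g y).
  have /fex[a aE] : g (y - u c) = 0 by rewrite linearB uE cE subrr.
  have [b bE] := fcover_surj a.
  by exists (b, c); rewrite pE bE aE subrK.
have inj1_lin : linear (fun x : Omega A => (val x, 0 : freemod R C)).
  by move=> a x y; congr pair; rewrite /= scaler0 addr0.
have snd_lin : linear (fun x : sub (kersm p) => (val x).2) by [].
have inj1_ker x : kersm p (mklin inj1_lin x).
  change (f (fcover A (val x)) + u 0 = 0).
  by rewrite (sub_valP x) !linear0 addr0.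
have snd_ker x : kersm (fcover C) (mklin snd_lin x).
  change (fcover C (val x).2 = 0); rewrite -uE.
  have /(congr1 g) : p (val x) = 0 := sub_valP x.
  by rewrite pE linearD linear0 (ses_comp0 fg) add0r.
have [f' f'E] := sub_lift inj1_ker; have [g' g'E] := sub_lift snd_ker.
exists (sub (kersm p)), f', g'; split; last first.
  by apply: pd_le_cover_kernel => //; apply: prod_projective; apply: freemod_projective.
split=> [|y|z].
- by move=> x y /(congr1 val); rewrite !f'E => -[/val_inj].
- split=> [y0|[x <-]]; last by apply: val_inj; rewrite g'E /= f'E.
  have y2 : (val y).2 = 0 by have := congr1 val y0; rewrite g'E.
  have y1 : fcover A (val y).1 = 0.
    have : p (val y) = 0 := sub_valP y.
    by rewrite pE y2 linear0 addr0 -(linear0 f) => /fi.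
  exists (sub_intro (P := kersm (fcover A)) y1); apply: val_inj; rewrite f'E.
  by rewrite [RHS]surjective_pairing y2.
- have /fex[a aE] : g (- u (val z)) = 0.
    by rewrite linearN uE (sub_valP z) oppr0.
  have [b bE] := fcover_surj a.
  have pz : kersm p (b, val z) by change (p (b, val z) = 0); rewrite pE bE aE addNr.
  by exists (sub_intro (P := kersm p) pz); apply: val_inj; rewrite g'E.
Qed.

(* The character sequence splits since its kernel is injective.  If k is not a
   solution in K of the equation expressing i k in Q, separate it by a character
   of K; extended to Q by the linear section, it kills i k. *)
Lemma flat_local (S : pzRingType) (t : antiiso R S) K Q C
    (i : {linear K -> Q}) (p : {linear Q -> C}) :
  ses i p -> is_projective Q -> is_injective (character t C) ->
  forall k, exists theta : {linear Q -> K}, theta (i k) = k.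
Proof.
move=> ip /projective_section[s sE] Ci k.
pose v := s (i k); pose l := fsupp v.
pose A (z : K) := exists y : Q -> K, z = \sum_(x <- l) coef x v *: y x.
have gA : subgroup A.
  split; first by exists (fun=> 0); rewrite big1 // => x _; rewrite scaler0.
  move=> _ _ [y ->] [y' ->]; exists (fun x => y x - y' x).
  by rewrite -sumrB; apply: eq_bigr => x _; rewrite scalerBr.
have [[y yE]|nA] := pselect (A k).
  exists (flin y \o s); rewrite -[LHS]/(flin y v) [RHS]yE {1}(free_decomp v) linear_sum.
  by apply: eq_bigr => x _; rewrite linearZZ flinE.
have [h [hA hk]] := character_separation gA nA; case: hk.
pose chi := mkchr t (@raddfB _ _ h).
have [_ _ [sg sgE]] := ses_section (ses_chr t ip) (ext1_injective Ci).
have sgchi z : chr_fun (sg chi) (i z) = h z.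
  by have := congr1 (fun c => chr_fun c z) (sgE chi).
have ik : i k = \sum_(x <- l) coef x v *: x.
  rewrite -[LHS](sE (i k)) -/v {1}(free_decomp v) linear_sum.
  by apply: eq_bigr => x _; rewrite linearZZ fcoverE.
rewrite -sgchi ik raddf_sum big_seq big1 // => x xl.
rewrite -[coef x v](aiVK t) -chrZE -linearZZ.
(* Every multiple of a coefficient of [v] lies in [A], by a family [y] concentrated at one index,
   and [h] vanishes on [A]. *)
have -> : aiinv t (coef x v) *: chi = 0.
  apply: chrP => z; rewrite chrZE aiVK.
  apply: hA; exists (fun x' => if x' == x then z else 0).
  rewrite (bigD1_seq x) ?fsupp_uniq //= eqxx big1 ?addr0 // => x' /negPf ->.
  by rewrite scaler0.
by rewrite linear0.
Qed.

End Dimensions.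

(** Dualizing the free cover embeds the character module of [M] in an injective, with the character
    module of [Omega M] as cokernel. *)
Lemma pd_le_chr (R S : pzRingType) (t : antiiso R S) n (M : lmodType R) :
  pd_le n M -> id_le n (character t M).
Proof.
elim: n M => [|n IH] M pdM.
  have Mp : is_projective M by move/pd_le_Omega: pdM.
  by apply/id_le_Sigma; apply: chr_projective.
have Ei := chr_projective (t := t) (@freemod_projective R M).
apply: (id_le_shift n (ses_chr t (ses_Omega M)) Ei).1; apply: IH.
exact: (pd_le_shift n (ses_Omega M) freemod_projective).2.
Qed.


(** * Comparison with resolutions *)

Section Resolutions.
Context {R : pzRingType}.
Implicit Types A B C E F K M P Q X Y : lmodType R.

Section Zero.
Variable M : lmodType R.

Definition zeromod : lmodType R := sub (kersm (idfun : {linear M -> M})).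

Lemma zeromod_zero : is_zero_module zeromod.
Proof. by move=> x; apply: val_inj; apply: (sub_valP x). Qed.

Lemma zeromod_projective : is_projective zeromod.
Proof.
move=> A B g f gs; exists (\0 : {linear zeromod -> A}) => x.
by rewrite [x]zeromod_zero !linear0.
Qed.

Lemma zeromod_injective : is_injective zeromod.
Proof.
move=> A B i f ii; exists (\0 : {linear B -> zeromod}) => x.
by rewrite [RHS]zeromod_zero.
Qed.

End Zero.

(** The free cover of [M] is spliced onto a resolution of [Omega M]; for [n = 0] the module resolves
    itself. *)
Lemma projective_resolution_of_pd_le n M : pd_le n M ->
  exists P : projective_resolution M, forall i, (n < i)%N -> is_zero_module (P i).
Proof.
elim: n M => [|n IH] M pdM.
  pose obj i : lmodType R := if i is 0 then M else zeromod M.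
  pose diff i : {linear obj i.+1 -> obj i} := \0.
  unshelve eexists (@Build_projective_resolution R M obj diff idfun _ _ _ _).
  - by move=> [|i]; [apply/(pd_le_Omega 0) | apply: zeromod_projective].
  - by move=> m; exists m.
  - by move=> y; split=> [y0|[x <-]//]; exists 0; apply: esym y0.
  - move=> i y; split=> [_|[x <-]]; last exact: linear0.
    by exists 0; rewrite [RHS]zeromod_zero.
  by move=> [|i] // _; apply: zeromod_zero.
have sO := ses_Omega M; have [iO exO sO'] := sO.
have [P P0] := IH _ ((pd_le_shift n sO freemod_projective).2 pdM).
pose obj i : lmodType R := if i is j.+1 then P j else freemod R M.
pose diff i : {linear obj i.+1 -> obj i} :=
  match i with
  | 0 => (sub_incl _ \o pres_aug P : {linear obj 1 -> obj 0})
  | j.+1 => pres_diff P j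
  end.
unshelve eexists (@Build_projective_resolution R M obj diff (fcover M) _ _ _ _).
- by move=> [|i]; [apply: freemod_projective | apply: pres_proj].
- exact: sO'.
- move=> y; rewrite exO; split=> [[x <-]|[x <-]].
    by have [z <-] := pres_aug_surj P x; exists z.
  by exists (pres_aug P x).
- move=> [|i]; last exact: pres_exactS.
  suff : exact_at (pres_diff P 0%N) (sub_incl _ \o pres_aug P) by [].
  move=> y; rewrite -(@pres_exact0 _ _ P y); split=> y0.
    by apply: iO; rewrite linear0.
  by rewrite -[LHS]/(sub_incl _ (pres_aug P y)) y0 linear0.
by move=> [|i] // ni; apply: P0.
Qed.

(** The resolution with its degree 0 term removed resolves the kernel of the augmentation; for
    [n = 0] the augmentation is invertible. *)
Lemma pd_le_of_projective_resolution n M (P : projective_resolution M) :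
  (forall i, (n < i)%N -> is_zero_module (P i)) -> pd_le n M.
Proof.
elim: n M P => [|n IH] M P P0.
  have [k kE] : exists k : {linear M -> P 0%N}, forall y, k (pres_aug P y) = y.
    apply: (descend (h := idfun)); first exact: pres_aug_surj.
    move=> y /(@pres_exact0 _ _ P _)[x <-] /=.
    by rewrite [x](P0 1%N) // linear0.
  apply/(pd_le_Omega 0); apply: (retract_projective (s := k) (r := pres_aug P)).
    by move=> x; have [y <-] := pres_aug_surj P x; rewrite kE.
  exact: pres_proj.
have sK := ses_ker (@pres_aug_surj _ _ P).
have [shift _] := pd_le_shift n sK (@pres_proj _ _ P 0%N); apply: shift.
have [|d dE] := @sub_lift _ _ (kersm (pres_aug P)) _ (pres_diff P 0%N).
  by move=> x; apply/(@pres_exact0 _ _ P _); exists x.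
unshelve eapply (IH _ (@Build_projective_resolution R _
  (fun i => P i.+1) (fun i => pres_diff P i.+1) d _ _ _ _)).
- by move=> i; apply: pres_proj.
- move=> m; have /(@pres_exact0 _ _ P _)[x xE] := sub_valP m.
  by exists x; apply: val_inj; rewrite dE.
- move=> y; rewrite -(@pres_exactS _ _ P 0%N y) -dE.
  by split=> [->//|y0]; apply: val_inj.
- by move=> i; apply: pres_exactS.
by move=> i ni; apply: P0.
Qed.

Lemma injective_resolution_of_id_le n X : id_le n X ->
  exists I : injective_resolution X, forall i, (n < i)%N -> is_zero_module (I i).
Proof.
elim: n X => [|n IH] X idX.
  pose obj i : lmodType R := if i is 0 then X else zeromod X.
  pose diff i : {linear obj i -> obj i.+1} := \0.
  unshelve eexists (@Build_injective_resolution R X obj diff idfun _ _ _ _).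
  - by move=> [|i]; [apply/(id_le_Sigma 0) | apply: zeromod_injective].
  - by [].
  - by move=> y; split=> [_|[x <-]]; [exists y | rewrite [LHS]zeromod_zero].
  - move=> i y; split=> [_|[x <-]]; last exact: linear0.
    by exists 0; rewrite [RHS]zeromod_zero.
  by move=> [|i] // _; apply: zeromod_zero.
have sS := ses_Sigma X; have [iS exS qS] := sS.
have [I I0] := IH _ ((id_le_shift n sS (@icover_injective _ X)).2 idX).
pose obj i : lmodType R := if i is j.+1 then I j else icover X.
pose diff i : {linear obj i -> obj i.+1} :=
  match i with
  | 0 => (ires_aug I \o quot_proj _ : {linear obj 0 -> obj 1})
  | j.+1 => ires_diff I j
  end.
unshelve eexists (@Build_injective_resolution R X obj diff (icover_emb X) _ _ _ _).
- by move=> [|i]; [apply: icover_injective | apply: ires_inj].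
- exact: iS.
- move=> y; rewrite -exS; split=> [y0|y0].
    by apply: (@ires_aug_inj _ _ I); rewrite linear0.
  by rewrite -[LHS]/(ires_aug I (quot_proj _ y)) y0 linear0.
- move=> [|i]; last exact: ires_exactS.
  suff : exact_at (ires_aug I \o quot_proj _) (ires_diff I 0%N) by [].
  move=> y; rewrite (@ires_exact0 _ _ I y); split=> [[x <-]|[x <-]].
    by have [z <-] := qS x; exists z.
  by exists (quot_proj _ x).
by move=> [|i] // ni; apply: I0.
Qed.

Lemma id_le_of_injective_resolution n X (I : injective_resolution X) :
  (forall i, (n < i)%N -> is_zero_module (I i)) -> id_le n X.
Proof.
elim: n X I => [|n IH] X I I0.
  have [k kE] : exists k : {linear I 0%N -> X}, forall y, ires_aug I (k y) = y.
    apply: (corestrict (h := idfun)); first exact: ires_aug_inj.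
    by move=> y; apply/(@ires_exact0 _ _ I _); rewrite [LHS](I0 1%N).
  apply/(id_le_Sigma 0); apply: (retract_injective (s := ires_aug I) (r := k)).
    by move=> x; apply: (@ires_aug_inj _ _ I); rewrite kE.
  exact: ires_inj.
have sQ := ses_quot (@ires_aug_inj _ _ I); have [_ exQ qs] := sQ.
have [shift _] := id_le_shift n sQ (@ires_inj _ _ I 0%N); apply: shift.
have [|d dE] := descend (h := ires_diff I 0%N) qs.
  by move=> y /exQ y0; apply/(@ires_exact0 _ _ I _).
unshelve eapply (IH _ (@Build_injective_resolution R _
  (fun i => I i.+1) (fun i => ires_diff I i.+1) d _ _ _ _)).
- by move=> i; apply: ires_inj.
- apply: injective_ker0 => x; have [y <-] := qs x.
  by rewrite dE => /(@ires_exact0 _ _ I _)/exQ.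
- move=> y; rewrite (@ires_exactS _ _ I 0%N y); split=> [[x <-]|[x <-]].
    by exists (quot_proj _ x); rewrite dE.
  by have [z <-] := qs x; exists z; rewrite dE.
- by move=> i; apply: ires_exactS.
by move=> i ni; apply: I0.
Qed.

Lemma projdim_le n M : natbar_le (projdim M) (Some n) <-> pd_le n M.
Proof.
split=> [|/projective_resolution_of_pd_le H]; last exact: natbar_inf_lb.
case E : (projdim M) => [k|//] /= kn.
have [P P0] := natbar_inf_mem E.
exact: pd_le_leq kn (pd_le_of_projective_resolution P0).
Qed.

Lemma injdim_le n X : natbar_le (injdim X) (Some n) <-> id_le n X.
Proof.
split=> [|/injective_resolution_of_id_le H]; last exact: natbar_inf_lb.
case E : (injdim X) => [k|//] /= kn.
have [I I0] := natbar_inf_mem E.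
exact: id_le_leq kn (id_le_of_injective_resolution I0).
Qed.

End Resolutions.

Lemma spli_le (R : pzRingType) n : natbar_le (spli R) (Some n) <->
  forall I : lmodType R, is_injective I -> pd_le n I.
Proof.
split=> [H I Ii|H]; last first.
  by apply: natbar_sup_least => _ [I Ii <-]; apply/projdim_le; apply: H.
apply/projdim_le; have : natbar_le (projdim I) (spli R).
  by apply: natbar_sup_ub; exists I.
by case: (projdim I) (spli R) H => [k|] [m|] //= mn km; apply: leq_trans mn.
Qed.

Lemma silp_le (R : pzRingType) n : natbar_le (silp R) (Some n) <->
  forall P : lmodType R, is_projective P -> id_le n P.
Proof.
split=> [H P Pp|H]; last first.
  by apply: natbar_sup_least => _ [P Pp <-]; apply/injdim_le; apply: H.
apply/injdim_le; have : natbar_le (injdim P) (silp R).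
  by apply: natbar_sup_ub; exists P.
by case: (injdim P) (silp R) H => [k|] [m|] //= mn km; apply: leq_trans mn.
Qed.


(** * Flat cycles in exact complexes of projectives *)

Section Supports.
Context {R : pzRingType} {B : choiceType}.
Local Notation L := (freemod R B).
Implicit Types (S T : set B) (v x y z : L).

Definition suppsm S : submod L.
Proof.
exists (fun v => forall b, ~ S b -> coef b v = 0) => // a v w Sv Sw b nS.
by rewrite coefD coefZ Sv // Sw // mulr0 addr0.
Defined.

Fact restrict_subproof S v :
  finsuppsm (fun b => if `[< S b >] then coef b v else 0).
Proof. by exists (fsupp v) => b /coef_fsupp ->; case: ifP. Qed.

Fact restrict_linear S : linear (fun v => sub_intro (restrict_subproof S v) : L).
Proof.
move=> a v w; apply: freeP => b.
change ((if `[< S b >] then a * coef b v + coef b w else 0) =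
  a * (if `[< S b >] then coef b v else 0) + if `[< S b >] then coef b w else 0).
by case: ifP => // _; rewrite mulr0 addr0.
Qed.

Definition restrict S : {linear L -> L} := mklin (@restrict_linear S).

Lemma coef_restrict S v b :
  coef b (restrict S v) = if `[< S b >] then coef b v else 0.
Proof. by []. Qed.

Lemma restrict_in S v : suppsm S (restrict S v).
Proof. by move=> b nS; rewrite coef_restrict asboolF. Qed.

Lemma restrict_id S v : suppsm S v -> restrict S v = v.
Proof.
move=> Sv; apply: freeP => b; rewrite coef_restrict.
by case: asboolP => // nS; rewrite Sv.
Qed.

Lemma restrict_decomp S v : restrict S v + restrict (~` S)%classic v = v.
Proof.
apply: freeP => b; rewrite coefD !coef_restrict asbool_neg.
by case: asboolP => _; rewrite ?addr0 ?add0r.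
Qed.

Lemma restrict_compl0 S v : suppsm S v <-> restrict (~` S)%classic v = 0.
Proof.
split=> [Sv|E]; last by rewrite -(restrict_decomp S v) E addr0; exact: restrict_in.
by apply: (addrI (restrict S v)); rewrite restrict_decomp addr0 restrict_id.
Qed.

Lemma suppsm_subset S T v : (S `<=` T)%classic -> suppsm S v -> suppsm T v.
Proof. by move=> ST Sv b nT; apply: Sv => /ST. Qed.

Lemma suppsm_basis S b : S b -> suppsm S (fbasis b).
Proof. by move=> Sb c nS; rewrite coef_fbasis; case: eqP => // E; rewrite E in nS. Qed.

Lemma suppsm_fsupp v : suppsm (fun b => b \in fsupp v) v.
Proof. by move=> b /negP; apply: coef_fsupp. Qed.

Lemma suppsm_ind (M : lmodType R) (T : submod M) (f : {linear L -> M}) S :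
  (forall b, S b -> T (f (fbasis b))) -> forall v, suppsm S v -> T (f v).
Proof.
move=> H v Sv; rewrite (free_decomp v) linear_sum.
elim/big_ind: _ => [|x y Tx Ty|b _]; [exact: sm0 | exact: smD |].
rewrite linearZZ; have [Sb|nS] := pselect (S b); first by apply/smZ/H.
by rewrite Sv // scale0r; apply: sm0.
Qed.

Lemma suppsm_linear S T (f : {linear L -> L}) :
  (forall b, S b -> suppsm T (f (fbasis b))) ->
  forall v, suppsm S v -> suppsm T (f v).
Proof. exact: suppsm_ind. Qed.

Lemma suppsm_ext (M : lmodType R) S (f g : {linear L -> M}) :
  (forall b, S b -> f (fbasis b) = g (fbasis b)) ->
  forall v, suppsm S v -> f v = g v.
Proof.
move=> H v Sv; apply/eqP; rewrite -subr_eq0; apply/eqP.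
apply: (suppsm_ind (T := kersm (idfun : {linear M -> M})) (f := f \- g) _ Sv).
by move=> b Sb; rewrite /= H // subrr.
Qed.

Lemma seq_union (P : B -> seq B -> Prop) (l : seq B) :
  (forall b m m', {subset m <= m'} -> P b m -> P b m') ->
  (forall b, exists m, P b m) -> exists m, forall b, b \in l -> P b m.
Proof.
move=> mono ex; elim: l => [|b l [m mE]]; first by exists [::].
have [m' m'E] := ex b; exists (m ++ m') => c; rewrite inE => /orP[/eqP ->|cl].
  by apply: mono m'E => d dm; rewrite mem_cat dm orbT.
by apply: mono (mE c cl) => d dm; rewrite mem_cat dm.
Qed.

Lemma subset_chain (l : nat -> seq B) : (forall n, {subset l n <= l n.+1}) ->
  forall m n, (m <= n)%N -> {subset l m <= l n}.
Proof.
move=> lS m n /subnK <-; elim: (n - m)%N => [//|k IH] b bl; rewrite addSn.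
by apply: lS; apply: IH.
Qed.

Lemma supp_chain (l : nat -> seq B) : (forall n, {subset l n <= l n.+1}) ->
  forall x, suppsm (fun b => exists n, b \in l n) x ->
  exists n, suppsm (fun b => b \in l n) x.
Proof.
move=> /subset_chain lle x Tx.
have [n nE] : exists n, forall b, b \in fsupp x ->
    (exists k, b \in l k) -> b \in l n.
  elim: (fsupp x) => [|b s [n nE]]; first by exists 0%N.
  have [[k bk]|nk] := pselect (exists k, b \in l k).
    exists (maxn n k) => d; rewrite inE => /orP[/eqP -> _|ds dk].
      by apply: lle bk; rewrite leq_maxr.
    by apply: lle (nE _ ds dk); rewrite leq_maxl.
  exists n => d; rewrite inE => /orP[/eqP ->|]; [by move/nk | exact: nE].
exists n => b bn; have [bx|/coef_fsupp//] := boolP (b \in fsupp x).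
by apply: Tx => bk; apply: bn; apply: nE.
Qed.

End Supports.

(** * Splitting a pure exact differential on a projective module *)

Section BensonGoodearl.
Context {R : pzRingType} {B : choiceType}.
Local Notation L := (freemod R B).
Local Notation "'endo'" := ({linear L -> L}).
Implicit Types (S T : set B) (x y z : L) (e f H : {linear L -> L}).

(* [e] projects the free module onto an arbitrary projective module, on which [f]
   is a differential with kernel equal to its image; [pploc] is purity of the
   image, a consequence of its flatness. *)
Record pure_periodic e f : Prop := PurePeriodic {
  ppee : forall x, e (e x) = e x;
  ppef : forall x, e (f x) = f x;
  ppfe : forall x, f (e x) = f x;
  ppff : forall x, f (f x) = 0;
  ppex : forall x, e x = x -> f x = 0 -> exists y, x = f y;
  pploc : forall y, exists eta : endo, f (eta (f y)) = f y }.

(* The span of [S] is compatible with [e], and both [f] restricted to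
   it and [f] induced on the quotient are again exact and pure; the quotient is
   represented on the same free module by composing with the projection off [S]. *)
Record good e f S : Prop := Good {
  good_e : forall x, suppsm S x -> suppsm S (e x);
  good_f : forall x, suppsm S x -> suppsm S (f x);
  good_ex : forall x, suppsm S x -> e x = x -> f x = 0 ->
    exists2 y, suppsm S y & x = f y;
  good_loc : forall y, suppsm S y -> exists eta : endo,
    (forall z, suppsm S (eta z)) /\ f (eta (f y)) = f y }.

Definition partial_inverse f S H := forall x, suppsm S x ->
  f (H x) = f x /\ (f x = 0 -> H x = 0).

Section Instance.
Variables e f : {linear L -> L}.
Hypothesis pp : pure_periodic e f.

(** On boundaries, 1 - f eta2 = (1 - f eta')(1 - f eta): the right factor kills the earlier elements
    and the left one what remains of the new element. *)
Lemma pploc_seq (ys : seq L) :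
  exists eta : endo, forall y, y \in ys -> f (eta (f y)) = f y.
Proof.
elim: ys => [|y ys [eta etaE]]; first by exists \0.
have [eta' eta'E] := pploc pp (y - eta (f y)).
pose eta2 : endo := eta \+ (eta' \o (idfun \- (f \o eta))).
exists eta2 => z zys.
have E w : eta2 (f w) = eta (f w) + eta' (f (w - eta (f w))).
  by rewrite /= [in RHS]linearB.
rewrite E [LHS]linearD; move: zys; rewrite inE => /orP[/eqP ->|/etaE zE].
  by rewrite eta'E linearB addrC subrK.
by rewrite linearB zE subrr !linear0 addr0.
Qed.

Section Quotient.
Variable S : set B.
Hypothesis gS : good e f S.
Let p : endo := restrict (~` S)%classic.

Let pS x : suppsm S x -> p x = 0.
Proof. by move/restrict_compl0. Qed.
Let p0S x : p x = 0 -> suppsm S x.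
Proof. by move/restrict_compl0. Qed.
Let qS x : suppsm S (x - p x).
Proof. by rewrite -{1}(restrict_decomp S x) addrK; apply: restrict_in. Qed.
Let pep x : p (e (p x)) = p (e x).
Proof.
apply/eqP; rewrite eq_sym -subr_eq0 -!linearB; apply/eqP/pS.
by apply: (good_e gS); apply: qS.
Qed.
Let pfp x : p (f (p x)) = p (f x).
Proof.
apply/eqP; rewrite eq_sym -subr_eq0 -!linearB; apply/eqP/pS.
by apply: (good_f gS); apply: qS.
Qed.

Lemma pure_periodic_quot : pure_periodic (p \o e) (p \o f).
Proof.
split=> [x|x|x|x|x|y].
- by rewrite -[LHS]/(p (e (p (e x)))) pep (ppee pp).
- by rewrite -[LHS]/(p (e (p (f x)))) pep (ppef pp).
- by rewrite -[LHS]/(p (f (p (e x)))) pfp (ppfe pp).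
- by rewrite -[LHS]/(p (f (p (f x)))) pfp (ppff pp) linear0.
- rewrite -[X in X = x -> _]/(p (e x)) -[X in _ -> X = 0 -> _]/(p (f x)) => ex fx.
  have pf : p (f (e x)) = 0 by rewrite (ppfe pp).
  (* A cycle of the quotient is lifted to a true cycle: [f (e x)] is a cycle over [S], hence some
     [f s], and [e (e x - s)] is killed by [f]. *)
  have [||s Ss sE] := good_ex gS (p0S pf).
  + by rewrite (ppef pp).
  + by rewrite (ppff pp).
  have [||y yE] := ppex pp (x := e (e x - s)).
  + by rewrite (ppee pp).
  + by rewrite (ppfe pp) linearB sE subrr.
  exists y; rewrite -[RHS]/(p (f y)) -yE linearB linearB (ppee pp) ex.
  by rewrite [p (e s)]pS ?subr0 //; apply: (good_e gS).
(* The representative [k'] of the boundary need not be a cycle, but [f k'] is a boundary from [S].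
   The local inverse [eS] over [S] corrects [k'] to the cycle [e k2], to which the purity of [f]
   applies. *)
pose k := f y; pose k' := p k; pose ks := k - k'.
have [eS [eSin eSE]] := good_loc gS (qS k : suppsm S ks).
have fkk' : f k' = - f ks by rewrite /ks linearB (ppff pp) sub0r opprK.
pose k2 := k' - eS (f k').
have fk2 : f (e k2) = 0.
  by rewrite (ppfe pp) linearB fkk' !linearN eSE opprK addNr.
have [||y2 y2E] := ppex pp (x := e k2) => //; first by rewrite (ppee pp).
have [eta etaE] := pploc pp y2.
exists (eta \o e \o (idfun \- (eS \o f))).
rewrite -[LHS]/(p (f (eta (e k2)))) -[RHS]/k' y2E etaE -y2E linearB linearB.
rewrite [p (e (eS _))]pS ?subr0; last by apply: (good_e gS); apply: eSin.
by rewrite /k' pep (ppef pp).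
Qed.

Variables (T : set B) (HS HT : endo).
Hypotheses (gT : good (p \o e) (p \o f) T) (iS : partial_inverse f S HS)
  (iT : partial_inverse (p \o f) T HT).

Let U : set B := (S `|` T)%classic.

Let pUT x : suppsm U x -> suppsm T (p x).
Proof.
move=> Ux b nT; rewrite coef_restrict; case: asboolP => // nS.
by apply: Ux => -[].
Qed.
Let SU x : suppsm S x -> suppsm U x.
Proof. by apply: suppsm_subset => b; left. Qed.
Let TU x : suppsm T x -> suppsm U x.
Proof. by apply: suppsm_subset => b; right. Qed.
Let decU x : suppsm T (p x) -> suppsm U x.
Proof. by move=> Tx; rewrite -(subrK (p x) x); apply: smD; [apply/SU/qS | apply: TU]. Qed.

(** Each condition holds over [T] up to an error supported in [S], which the goodness of [S]
    absorbs. *)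
Lemma good_extend : good e f U.
Proof.
split.
- move=> x Ux; apply: decU; rewrite -pep.
  exact: (good_e gT (pUT Ux)).
- move=> x Ux; apply: decU; rewrite -pfp.
  exact: (good_f gT (pUT Ux)).
- move=> x Ux ex fx.
  have [||y Ty yE] := good_ex gT (pUT Ux).
  + by rewrite -[LHS]/(p (e (p x))) pep ex.
  + by rewrite -[LHS]/(p (f (p x))) pfp fx linear0.
  have [|||s Ss sE] := good_ex gS (x := x - f y).
  + by apply: p0S; rewrite linearB yE; exact: subrr.
  + by rewrite linearB ex (ppef pp).
  + by rewrite linearB fx (ppff pp) subr0.
  exists (s + y); first by apply: smD; [apply: SU | apply: TU].
  by rewrite linearD -sE subrK.
move=> y Uy; have [eT [eTin eTE]] := good_loc gT (pUT Uy).
have {}eTE : p (f (eT (p (f y)))) = p (f y).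
  by move: eTE; rewrite -[LHS]/(p (f (eT (p (f (p y)))))) -[RHS]/(p (f (p y))) pfp.
pose w := f y - f (eT (p (f y))).
have [|||s Ss sE] := good_ex gS (x := w).
- by apply: p0S; rewrite /w linearB eTE subrr.
- by rewrite /w linearB !(ppef pp).
- by rewrite /w linearB !(ppff pp) subr0.
have [eS [eSin eSE]] := good_loc gS Ss.
exists ((eT \o p) \+ (eS \o (idfun \- (f \o eT \o p)))); split=> [z|].
  by apply: smD; [apply: TU; apply: eTin | apply: SU; apply: eSin].
rewrite -[LHS]/(f (eT (p (f y)) + eS w)) sE [LHS]linearD eSE -sE /w.
by rewrite addrC subrK.
Qed.

(* On the span of [T] the error [w] of [HT] lies in the cycles over [S], which [HS]
   lifts through [f]: H = HS on S, and H = HT + HS o f^-1 o w off S. *)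
Lemma partial_inverse_extend : exists H, partial_inverse f U H /\
  forall x, suppsm S x -> H x = HS x.
Proof.
pose w : endo := (f \- (f \o HT)) \o p.
have wP x : suppsm U x -> exists2 s, suppsm S s & f s = w x.
  move=> Ux; have [hT _] := iT (pUT Ux).
  have [|||s Ss sE] := good_ex gS (x := w x).
  - apply: p0S; rewrite -[w x]/(f (p x) - f (HT (p x))) linearB.
    by apply/eqP; rewrite subr_eq0 eq_sym; apply/eqP.
  - by rewrite -[w x]/(f (p x) - f (HT (p x))) linearB !(ppef pp).
  - by rewrite -[w x]/(f (p x) - f (HT (p x))) linearB !(ppff pp) subr0.
  by exists s.
have [c cP] : exists c : B -> L, forall b, U b -> suppsm S (c b) /\ f (c b) = w (fbasis b).
  apply: (@fun_choice _ _ (fun b s => U b -> suppsm S s /\ f s = w (fbasis b))) => b.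
  have [Ub|nU] := pselect (U b); last by exists 0.
  by have [s Ss sE] := wP _ (suppsm_basis Ub); exists s.
pose sg : endo := flin c.
have sgS x : suppsm U x -> suppsm S (sg x).
  by apply: suppsm_linear => b Ub; rewrite flinE; case: (cP b Ub).
have sgE x : suppsm U x -> f (sg x) = w x.
  apply: (suppsm_ext (f := f \o sg) (g := w)) => b Ub.
  by rewrite -[LHS]/(f (sg (fbasis b))) flinE; case: (cP b Ub).
pose H : endo := (HS \o (idfun \- p)) \+ (HT \o p) \+ (HS \o sg); exists H.
have HE x : H x = HS (x - p x) + HT (p x) + HS (sg x) by [].
split=> [x Ux|x Sx]; rewrite HE; last first.
  have px : p x = 0 by apply: pS.
  have Ux := SU Sx; have [_ h0] := iS (sgS x Ux).
  rewrite px subr0 linear0 addr0 h0 ?addr0 // sgE //.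
  by rewrite -[LHS]/(f (p x) - f (HT (p x))) px !linear0 addr0.
have [h1 _] := iS (qS x); have [_ h20] := iT (pUT Ux).
have [h3 _] := iS (sgS x Ux).
have wE : f (sg x) = f (p x) - f (HT (p x)) by rewrite sgE.
split.
  rewrite [LHS]linearD [X in X + _]linearD h1 h3 wE linearB.
  by rewrite -addrA [X in _ + X]addrC subrK subrK.
move=> fx; have HT0 : HT (p x) = 0.
  by apply: h20; rewrite -[LHS]/(p (f (p x))) pfp fx linear0.
rewrite HT0 addr0 -linearD.
have [|_ h4] := iS (x := x - p x + sg x); first by apply: smD => //; apply: sgS.
by apply: h4; rewrite linearD wE HT0 linear0 subr0 linearB subrK fx.
Qed.

End Quotient.

(* The kernel of [f] on the span of [l] need not be finitely generated, but it lies
   in the span of the [e b - e (eta (f b))], [b] in [l], for one [eta] inverting [f]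
   on [l]; so finitely many new basis elements make it bound. *)
Definition closing (l l' : seq B) : Prop :=
  let inl' := suppsm (fun b => b \in l') in
  [/\ {subset l <= l'},
     forall b, b \in l -> inl' (e (fbasis b)) /\ inl' (f (fbasis b)) &
     exists eta : endo, (forall z, inl' (eta z)) /\ forall b, b \in l ->
       f (eta (f (fbasis b))) = f (fbasis b) /\
       exists2 z, inl' z & e (fbasis b) - e (eta (f (fbasis b))) = f z].

Lemma closing_exists l : exists l', closing l l'.
Proof.
pose fb b := f (fbasis b).
have [eta0 eta0E] := pploc_seq [seq fbasis b | b <- l].
have {}eta0E b : b \in l -> f (eta0 (fb b)) = fb b.
  by move=> bl; apply: eta0E; apply: map_f.
have [m mE] : exists m : seq B, forall b, b \in l -> suppsm (fun c => c \in m) (fb b).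
  apply: seq_union => [b m m' mm'|b]; first exact: suppsm_subset.
  by exists (fsupp (fb b)); apply: suppsm_fsupp.
(* Cutting down to [m], which supports all the [fb b], makes the image of the map finitely generated
   and keeps its values on the [fb b]. *)
pose eta : endo := eta0 \o restrict (fun c => c \in m).
have etaE b : b \in l -> eta (fb b) = eta0 (fb b).
  by move=> /mE bm; rewrite -[LHS]/(eta0 (restrict _ (fb b))) restrict_id.
have [m1 m1E] : exists m1 : seq B, forall c, c \in m ->
    suppsm (fun d => d \in m1) (eta0 (fbasis c)).
  apply: seq_union => [b n n' nn'|b]; first exact: suppsm_subset.
  by exists (fsupp (eta0 (fbasis b))); apply: suppsm_fsupp.
have [z zE] : exists z : B -> L, forall b, b \in l ->
    e (fbasis b) - e (eta (fb b)) = f (z b).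
  apply: (@fun_choice _ _ (fun b z => b \in l ->
    e (fbasis b) - e (eta (fb b)) = f z)) => b.
  have [bl|nbl] := boolP (b \in l); last by exists 0.
  have [||y yE] := ppex pp (x := e (fbasis b) - e (eta (fb b))).
  - by rewrite linearB !(ppee pp).
  - by rewrite linearB !(ppfe pp) etaE // eta0E // subrr.
  by exists y.
have [m2 m2E] : exists m2 : seq B, forall b, b \in l ->
    [/\ suppsm (fun d => d \in m2) (z b), suppsm (fun d => d \in m2) (e (fbasis b)) &
      suppsm (fun d => d \in m2) (fb b)].
  apply: seq_union => [b n n' nn' [s1 s2 s3]|b].
    by split; [apply: (suppsm_subset _ s1) | apply: (suppsm_subset _ s2) |
      apply: (suppsm_subset _ s3)].
  exists (fsupp (z b) ++ fsupp (e (fbasis b)) ++ fsupp (fb b)).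
  by split; [apply: (suppsm_subset _ (@suppsm_fsupp _ _ (z b))) |
    apply: (suppsm_subset _ (@suppsm_fsupp _ _ (e (fbasis b)))) |
    apply: (suppsm_subset _ (@suppsm_fsupp _ _ (fb b)))] => d /= dm;
    rewrite !mem_cat dm ?orbT.
exists (l ++ m1 ++ m2).
have sub1 x : suppsm (fun d => d \in m1) x ->
    suppsm (fun d => d \in l ++ m1 ++ m2) x.
  by apply: suppsm_subset => d /= dm; rewrite !mem_cat dm orbT.
have sub2 x : suppsm (fun d => d \in m2) x ->
    suppsm (fun d => d \in l ++ m1 ++ m2) x.
  by apply: suppsm_subset => d /= dm; rewrite !mem_cat dm !orbT.
split=> [d dl|b /m2E[_ s2 s3]|]; first by rewrite mem_cat dl.
  by split; apply: sub2.
exists eta; split=> [x|b bl].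
  apply: sub1; apply: (suppsm_linear (f := eta0)) (@restrict_in _ _ _ _).
  exact: m1E.
split; first by rewrite etaE // eta0E.
by exists (z b); [case: (m2E b bl) => ? _ _; apply: sub2 | apply: zE].
Qed.

(* The approximations g' = g + eta (1 - f g) agree with g on f b whenever
   f g f b = f b, hence stabilize on each basis element. *)
Lemma countable_inverse (l : nat -> seq B) :
  (forall n, {subset l n <= l n.+1}) ->
  exists H, partial_inverse f (fun b => exists n, b \in l n) H.
Proof.
move=> lS; pose fb b := f (fbasis b).
pose ok n (g : endo) := forall b, b \in l n -> f (g (fb b)) = fb b.
have step (n : nat) (g : {g : endo | ok n g}) :
    {g' : {g' : endo | ok n.+1 g'} | forall b, b \in l n ->
      sval g' (fb b) = sval g (fb b)}.
  apply: cid; case: g => g gok /=.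
  have [eta etaE] := pploc_seq [seq fbasis b - g (fb b) | b <- l n.+1].
  pose g' : endo := g \+ (eta \o (idfun \- (f \o g))).
  have g'E b : g' (fb b) = g (fb b) + eta (f (fbasis b - g (fb b))).
    by rewrite /= [in RHS]linearB.
  have g'ok : ok n.+1 g'.
    move=> b bl; rewrite g'E linearD etaE; first by rewrite linearB addrC subrK.
    by apply: map_f bl.
  exists (exist _ g' g'ok) => b bl /=.
  by rewrite [LHS]g'E linearB gok // subrr linear0 addr0.
have g0 : {g : endo | ok 0%N g}.
  apply: cid; have [eta etaE] := pploc_seq [seq fbasis b | b <- l 0%N].
  by exists eta => b bl; apply: etaE; apply: map_f.
pose G := nat_rect (fun n => {g : endo | ok n g}) g0 (fun n g => sval (step n g)).
pose g n := sval (G n).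
have gok n b : b \in l n -> f (g n (fb b)) = fb b by exact: (svalP (G n)).
have gS n b : b \in l n -> g n.+1 (fb b) = g n (fb b).
  exact: (svalP (step n (G n))).
have lle := subset_chain lS.
have gle m n b : (m <= n)%N -> b \in l m -> g n (fb b) = g m (fb b).
  move=> /subnK <- bl; elim: (n - m)%N => [//|k IH]; rewrite addSn gS ?IH //.
  by apply: lle bl; rewrite leq_addl.
have [c cE] : exists c : B -> L, forall b n, b \in l n -> c b = g n (fb b).
  apply: (@fun_choice _ _ (fun b c => forall n, b \in l n -> c = g n (fb b))) => b.
  have [[n bn]|nb] := pselect (exists n, b \in l n); last first.
    by exists 0 => n bn; case: nb; exists n.
  exists (g n (fb b)) => m bm; have [nm|/ltnW mn] := leqP n m.
    by rewrite (gle n m).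
  by rewrite (gle m n).
exists (flin c) => x Tx.
have [n xn] := supp_chain lS Tx.
have HE : flin c x = g n (f x).
  apply: (suppsm_ext (f := flin c) (g := g n \o f)) xn => b bn.
  by rewrite flinE (cE b n).
split; last by move=> fx; rewrite HE fx linear0.
rewrite HE; apply: (suppsm_ext (f := f \o g n \o f) (g := f)) xn => b bn.
by rewrite /= gok.
Qed.

(** [T] is the union of the iterated closings of [b0]. An element of its span is supported at a
    finite stage, and what it requires is supported at the next one. *)
Lemma countable_good b0 : exists T H,
  [/\ T b0, good e f T & partial_inverse f T H].
Proof.
have [cl clE] := fun_choice closing_exists.
pose l n := iter n cl [:: b0].
have lS n : {subset l n <= l n.+1} by case: (clE (l n)).
have [H HP] := countable_inverse lS.
exists (fun b => exists n, b \in l n), H; split=> //.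
  by exists 0%N; rewrite inE.
have finT := supp_chain lS.
have Tl n x : suppsm (fun b => b \in l n) x ->
    suppsm (fun b => exists n, b \in l n) x.
  by apply: suppsm_subset => b bn; exists n.
split.
- move=> x /finT[n]; move: (clE (l n)) => [_ ef _] xn; apply: (Tl n.+1).
  by apply: suppsm_linear xn => b /ef[].
- move=> x /finT[n]; move: (clE (l n)) => [_ ef _] xn; apply: (Tl n.+1).
  by apply: suppsm_linear xn => b /ef[].
- move=> x /finT[n] xn ex fx.
  have [_ _ [eta [_ etaE]]] := clE (l n).
  have [c cE] : exists c : B -> L, forall b, b \in l n ->
      suppsm (fun b => b \in l n.+1) (c b) /\
      e (fbasis b) - e (eta (f (fbasis b))) = f (c b).
    apply: (@fun_choice _ _ (fun b c => b \in l n -> suppsm (fun b => b \in l n.+1) c /\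
      e (fbasis b) - e (eta (f (fbasis b))) = f c)) => b.
    have [bl|nbl] := boolP (b \in l n); last by exists 0.
    by have [_ [z zl zE]] := etaE b bl; exists z.
  exists (flin c x).
    apply: (Tl n.+1); apply: suppsm_linear xn => b bl; rewrite flinE.
    by case: (cE b bl).
  (* As [e x = x] and [f x = 0], the cycle is [e x - e (eta (f x))], which the closing data write as
     a boundary. *)
  rewrite -[LHS]ex -[LHS]subr0 -(linear0 e) -(linear0 eta) -fx.
  apply: (suppsm_ext (f := e \- (e \o eta \o f)) (g := f \o flin c)) xn => b bl.
  by rewrite -[RHS]/(f (flin c (fbasis b))) flinE; case: (cE b bl).
move=> y /finT[n] yn; have [_ _ [eta [etal etaE]]] := clE (l n).
exists eta; split=> [z|]; first exact: (Tl n.+1).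
apply: (suppsm_ext (f := f \o eta \o f) (g := f)) yn => b bl.
by case: (etaE b bl).
Qed.

End Instance.
(** Zorn's lemma for pairs of a good set and a partial inverse over it. A pair is encoded by the
    graph of the inverse on basis elements, so that extension becomes inclusion. *)
Theorem pure_periodic_inverse e f : pure_periodic e f ->
  exists H, forall x, f (H x) = f x /\ (f x = 0 -> H x = 0).
Proof.
move=> pp.
pose graph S H : set (B * L) := [set u | S u.1 /\ u.2 = H (fbasis u.1)]%classic.
pose P (G : set (B * L)) := exists S H,
  [/\ good e f S, partial_inverse f S H & G = graph S H].
have nil0 x : suppsm set0 x -> x = 0 by move=> Sx; apply: freeP => b; rewrite Sx.
have P0 : P (graph set0 \0).
  exists set0, \0; split=> //; last by move=> x /nil0 ->; rewrite !linear0.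
  split=> [x /nil0 ->|x /nil0 ->|x /nil0 -> _ _|y /nil0 ->].
  - by rewrite linear0; apply: sm0.
  - by rewrite linear0; apply: sm0.
  - by exists 0; [apply: sm0 | rewrite linear0].
  - by exists \0; split=> [z|]; [apply: sm0 | rewrite !linear0].
have [F [X0 FX0] FP totF|G [[S [H [gS iS GE]]] _ maxG]] := Zorn_above P0.
  pose U : set B := [set b | exists X y, F X /\ X (b, y)]%classic.
  have XU X S H : F X -> X = graph S H -> (S `<=` U)%classic.
    by move=> FX XE b Sb; exists X, (H (fbasis b)); rewrite XE in FX *.
  have suppF x : suppsm U x -> exists X S H,
      [/\ F X, X = graph S H, good e f S, partial_inverse f S H & suppsm S x].
    move=> Ux.
    (* The support of [x] is finite and [F] is a chain, so one member covers the part of the support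
       lying in [U]. *)
    have [X FX XE] : exists2 X, F X &
        forall b, b \in fsupp x -> U b -> exists y, X (b, y).
      elim: (fsupp x) => [|b s [X FX XE]]; first by exists X0.
      have [[Y [y [FY Yb]]]|nb] := pselect (U b); last first.
        by exists X => // c; rewrite inE => /orP[/eqP ->|]; [move/nb | apply: XE].
      have [XY|YX] := totF _ _ FX FY; [exists Y => // | exists X => //] => c;
        rewrite inE => /orP[/eqP -> _|cs /(XE c cs)[z Xz]].
      - by exists y.
      - by exists z; apply: XY.
      - by exists y; apply: YX.
      - by exists z.
    have [S [H [gS iS XG]]] := FP _ FX.
    exists X, S, H; split=> // b nS.
    have [bx|/coef_fsupp//] := boolP (b \in fsupp x).
    apply: Ux => /(XE b bx)[y]; rewrite XG => -[Sb _]; exact: nS.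
  have [c cE] : exists c : B -> L, forall b X y, F X -> X (b, y) -> c b = y.
    apply: (@fun_choice _ _ (fun b z => forall X y, F X -> X (b, y) -> z = y)) => b.
    have [[X [y [FX Xb]]]|nb] := pselect (U b); last first.
      by exists 0 => X y FX Xb; case: nb; exists X, y.
    exists y => Y z FY Yz.
    have fn Z u v : F Z -> Z (b, u) -> Z (b, v) -> u = v.
      by case/FP=> [S [H [_ _ ->]]] [_ /= ->] [_ /= ->].
    have [XY|YX] := totF _ _ FX FY; first by apply: fn FY _ Yz; apply: XY.
    by apply: (fn _ _ _ FX Xb); apply: YX.
  have cH X S H : F X -> X = graph S H -> forall x, suppsm S x -> flin c x = H x.
    move=> FX XE; apply: suppsm_ext => b Sb; rewrite flinE.
    by apply: cE FX _; rewrite XE.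
  exists U, (flin c); split.
  - split=> [x|x|x|y] /suppF[X [S [H [FX XE gS iS Sx]]]].
    + by apply: (suppsm_subset (XU _ _ _ FX XE)); apply: (good_e gS).
    + by apply: (suppsm_subset (XU _ _ _ FX XE)); apply: (good_f gS).
    + move=> ex fx; have [y Sy yE] := good_ex gS Sx ex fx.
      by exists y => //; apply: (suppsm_subset (XU _ _ _ FX XE)).
    + have [eta [etaS etaE]] := good_loc gS Sx; exists eta; split=> // z.
      by apply: (suppsm_subset (XU _ _ _ FX XE)); apply: etaS.
  - move=> x /suppF[X [S [H [FX XE gS iS Sx]]]].
    by rewrite (cH _ _ _ FX XE x Sx); apply: iS.
  apply/seteqP; split=> [[b y] [X FX Xb]|[b y] [[X [z [FX Xb]]]]].
    split; first by exists X, y.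
    by rewrite -[RHS]/(flin c (fbasis b)) flinE (cE _ _ _ FX Xb).
  rewrite -[RHS]/(flin c (fbasis b)) flinE (cE _ _ _ FX Xb) => /= ->.
  by exists X.
have allS b : S b.
  apply: contrapT => nS.
  (* The maps induced modulo the span of [S] satisfy the same hypotheses; a countable good set
     through [b] for them is glued to [S], against maximality. *)
  have [T [HT [Tb gT iT]]] := countable_good (pure_periodic_quot pp gS) b.
  have [H' [iU HU]] := partial_inverse_extend pp gS iS iT.
  have /maxG : P (graph (S `|` T)%classic H').
    by exists (S `|` T)%classic, H'; split=> //; exact: (good_extend pp gS gT).
  rewrite GE => sub; apply: nS.
  suff : graph S H (b, H' (fbasis b)) by case.
  apply: sub; last by split=> //; right.
  move=> [d y] [/= Sd ->]; split; first by left.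
  by rewrite -[RHS]/(H' (fbasis d)) HU //; apply: suppsm_basis.
exists H => x; apply: iS => b nS; case: nS; exact: allS.
Qed.

End BensonGoodearl.


(** * Countable direct products and direct sums of modules *)

Section DirectProduct.
Context {R : pzRingType}.
Variable Q : nat -> lmodType R.

Definition dprod : Type := forall j, Q j.
HB.instance Definition _ := gen_eqMixin dprod.
HB.instance Definition _ := gen_choiceMixin dprod.

Let add (x y : dprod) : dprod := fun j => x j + y j.
Let opp (x : dprod) : dprod := fun j => - x j.
Let scale a (x : dprod) : dprod := fun j => a *: x j.

Fact dprod_addA : associative add.
Proof. by move=> x y z; apply: functional_extensionality_dep => j; apply: addrA. Qed.
Fact dprod_addC : commutative add.
Proof. by move=> x y; apply: functional_extensionality_dep => j; apply: addrC. Qed.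
Fact dprod_add0 : left_id (fun=> 0) add.
Proof. by move=> x; apply: functional_extensionality_dep => j; apply: add0r. Qed.
Fact dprod_addN : left_inverse (fun=> 0) opp add.
Proof. by move=> x; apply: functional_extensionality_dep => j; apply: addNr. Qed.
HB.instance Definition _ := GRing.isZmodule.Build dprod
  dprod_addA dprod_addC dprod_add0 dprod_addN.

Fact dprod_scaleA a b v : scale a (scale b v) = scale (a * b) v.
Proof. by apply: functional_extensionality_dep => j; apply: scalerA. Qed.
Fact dprod_scale1 : left_id 1 scale.
Proof. by move=> v; apply: functional_extensionality_dep => j; apply: scale1r. Qed.
Fact dprod_scaleDr : right_distributive scale +%R.
Proof. by move=> a u v; apply: functional_extensionality_dep => j; apply: scalerDr. Qed.
Fact dprod_scaleDl v : {morph scale^~ v : a b / a + b}.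
Proof. by move=> a b; apply: functional_extensionality_dep => j; apply: scalerDl. Qed.
HB.instance Definition _ := GRing.Zmodule_isLmodule.Build R dprod
  dprod_scaleA dprod_scale1 dprod_scaleDr dprod_scaleDl.

End DirectProduct.

Section DirectSum.
Context {R : pzRingType}.
Variable Q : nat -> lmodType R.

Definition dsumsm : submod (dprod Q).
Proof.
exists (fun x : dprod Q => exists n, forall j, (n <= j)%N -> x j = 0).
  by exists 0%N.
move=> a x y [n nE] [m mE]; exists (maxn n m) => j; rewrite geq_max => /andP[nj mj].
by rewrite -[LHS]/(a *: x j + y j) nE // mE // scaler0 addr0.
Defined.

Definition dsum : lmodType R := sub dsumsm.

Fact dcomp_linear (j : nat) : linear (fun x : dsum => val x j).
Proof. by []. Qed.
Definition dcomp j : {linear dsum -> Q j} := mklin (@dcomp_linear j).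

Lemma dsumP (x y : dsum) : (forall j, dcomp j x = dcomp j y) -> x = y.
Proof. by move=> H; apply: val_inj; apply: functional_extensionality_dep. Qed.

Let dinj_fun (j : nat) (v : Q j) : dprod Q := fun i =>
  match @eqP _ j i with ReflectT E => ecast i (Q i) E v | ReflectF _ => 0 end.

Fact dinj_subproof (j : nat) (v : Q j) : dsumsm (dinj_fun v).
Proof.
exists j.+1 => i ji; rewrite /dinj_fun; case: eqP => // E.
by rewrite E ltnn in ji.
Qed.

Fact dinj_linear (j : nat) : linear (fun v : Q j => sub_intro (dinj_subproof v) : dsum).
Proof.
move=> a v w; apply: dsumP => i; rewrite linearP.
rewrite -[LHS]/(dinj_fun (a *: v + w) i) -[RHS]/(a *: dinj_fun v i + dinj_fun w i).
rewrite /dinj_fun; case: eqP => [E|_]; last by rewrite scaler0 addr0.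
by case: i / E.
Qed.
Definition dinj j : {linear Q j -> dsum} := mklin (@dinj_linear j).

Lemma dcomp_dinj j v : dcomp j (dinj j v) = v.
Proof.
rewrite -[LHS]/(dinj_fun v j) /dinj_fun; case: eqP => // E.
by rewrite (eq_irrelevance E erefl).
Qed.

Lemma dcomp_dinj0 i j v : i <> j -> dcomp i (dinj j v) = 0.
Proof.
by move=> ij; rewrite -[LHS]/(dinj_fun v i) /dinj_fun; case: eqP => // E; case: ij.
Qed.

Lemma dsum_decomp (x : dsum) n : (forall j, (n <= j)%N -> dcomp j x = 0) ->
  x = \sum_(j < n) dinj j (dcomp j x).
Proof.
move=> nE; apply: dsumP => i; rewrite linear_sum.
have [ni|ni] := leqP n i.
  rewrite nE // big1 // => j _; apply: dcomp_dinj0 => ij.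
  by have := ltn_ord j; rewrite -ij ltnNge ni.
rewrite (bigD1 (Ordinal ni)) // big1 => [|j ji].
  by rewrite [RHS]addr0; apply: esym (dcomp_dinj _).
by apply: dcomp_dinj0 => ij; case/eqP: ji; apply: val_inj.
Qed.

Lemma dsum_bound (x : dsum) : exists n, forall j, (n <= j)%N -> dcomp j x = 0.
Proof. exact: sub_valP x. Qed.

Lemma dsum_projective : (forall j, is_projective (Q j)) -> is_projective dsum.
Proof.
move=> Qp A B g f gs.
have ex j : exists h : {linear Q j -> A}, forall v, g (h v) = f (dinj j v).
  by have [h hE] := Qp j _ _ g (f \o dinj j) gs; exists h.
pose h j := projT1 (cid (ex j)).
have hE j v : g (h j v) = f (dinj j v) by rewrite /h; case: cid.
have [b bE] := fun_choice dsum_bound.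
pose k (x : dsum) := \sum_(j < b x) h j (dcomp j x).
(* The sum does not depend on the chosen bound, so linearity can be checked at a bound common to all
   the vectors involved. *)
have kE x n : (forall j, (n <= j)%N -> dcomp j x = 0) ->
    k x = \sum_(j < n) h j (dcomp j x).
  have widen m : (m <= maxn (b x) n)%N -> (forall j, (m <= j)%N -> dcomp j x = 0) ->
      \sum_(j < m) h j (dcomp j x) = \sum_(j < maxn (b x) n) h j (dcomp j x).
    move=> le mE; rewrite (big_ord_widen _ (fun j => h j (dcomp j x)) le) big_mkcond.
    by apply: eq_bigr => j _; case: ltnP => // /mE ->; rewrite linear0.
  move=> nE; rewrite /k (widen _ (leq_maxl _ _) (bE x)).
  by rewrite (widen n (leq_maxr _ _) nE).
have lin : linear k.
  move=> a x y; pose n := maxn (b x) (b y).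
  have nx j : (n <= j)%N -> dcomp j x = 0.
    by rewrite geq_max => /andP[xj _]; apply: bE.
  have ny j : (n <= j)%N -> dcomp j y = 0.
    by rewrite geq_max => /andP[_ yj]; apply: bE.
  rewrite (kE _ n) => [|j nj]; last by rewrite linearP nx // ny // scaler0 addr0.
  rewrite (kE x n) // (kE y n) // scaler_sumr -big_split /=.
  by apply: eq_bigr => j _; rewrite !linearP.
exists (mklin lin) => x; rewrite {2}(dsum_decomp (bE x)) !linear_sum.
by apply: eq_bigr => j _; apply: hE.
Qed.

End DirectSum.
Arguments dcomp {R Q} j.
Arguments dinj {R Q} j.

(** * Folding an exact complex of projectives into one module *)

Section Complex.
Context {R : pzRingType}.
Variables (Q : nat -> lmodType R) (d : forall j, {linear Q j -> Q j.+1}).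
Hypothesis Qp : forall j, is_projective (Q j).
Hypothesis d0 : injective (d 0%N).
Hypothesis dex : forall j, exact_at (d j) (d j.+1).
Hypothesis dloc : forall j (y : Q j), exists eta : {linear Q j.+1 -> Q j},
  d j (eta (d j y)) = d j y.

Let D := dsum Q.

Let dd_fun (x : D) : dprod Q := fun j =>
  if j is i.+1 then d i (dcomp i x) else 0.

Let dd_subproof x : dsumsm Q (dd_fun x).
Proof.
have [n nE] := dsum_bound x.
by exists n.+1 => -[|j] // nj; rewrite -[LHS]/(d j (dcomp j x)) nE // linear0.
Qed.

Let dd_linear : linear (fun x => sub_intro (dd_subproof x) : D).
Proof.
move=> a x y; apply: dsumP => -[|j]; rewrite linearP.
  by rewrite -[LHS]/(0 : Q 0%N) -[RHS]/(a *: 0 + 0) scaler0 addr0.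
rewrite -[LHS]/(d j (dcomp j (a *: x + y))).
by rewrite -[RHS]/(a *: d j (dcomp j x) + d j (dcomp j y)) !linearP.
Qed.

Let dd : {linear D -> D} := mklin dd_linear.

Let ddS j x : dcomp j.+1 (dd x) = d j (dcomp j x). Proof. by []. Qed.
Let dd0 x : dcomp 0%N (dd x) = 0. Proof. by []. Qed.

Let dd_dd x : dd (dd x) = 0.
Proof.
apply: dsumP => j; rewrite linear0; case: j => [//|[|j]]; rewrite ddS.
  by rewrite dd0 linear0.
by rewrite ddS; apply/dex; exists (dcomp j x).
Qed.

Let dd_exact x : dd x = 0 -> exists y, x = dd y.
Proof.
move=> dx; have dxj j : d j (dcomp j x) = 0 by rewrite -ddS dx linear0.
(* Zero components receive the preimage 0, which keeps the chosen family finitely supported. *)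
have ex j : exists v : Q j, d j v = dcomp j.+1 x /\ (dcomp j.+1 x = 0 -> v = 0).
  have [->|nz] := pselect (dcomp j.+1 x = 0); first by exists 0; rewrite linear0.
  by have /dex[v vE] := dxj j.+1; exists v.
pose v : dprod Q := fun j => projT1 (cid (ex j)).
have vE j : d j (v j) = dcomp j.+1 x /\ (dcomp j.+1 x = 0 -> v j = 0).
  by rewrite /v; case: cid.
have vs : dsumsm Q v.
  have [n nE] := dsum_bound x; exists n => j nj.
  by have [_] := vE j; apply; apply: nE; apply: leqW.
exists (sub_intro vs); apply: dsumP => -[|j].
  by rewrite dd0; apply: d0; rewrite dxj linear0.
by rewrite ddS; have [] := vE j.
Qed.

Let dd_local x : exists eta : {linear D -> D}, dd (eta (dd x)) = dd x.
Proof.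
pose eta j := projT1 (cid (dloc (dcomp j x))).
have etaE j : d j (eta j (d j (dcomp j x))) = d j (dcomp j x).
  by rewrite /eta; case: cid.
pose F (y : D) : dprod Q := fun j => eta j (dcomp j.+1 y).
have Fs y : dsumsm Q (F y).
  have [n nE] := dsum_bound y; exists n => j nj.
  by rewrite /F nE ?linear0 // leqW.
have lin : linear (fun y => sub_intro (Fs y) : D).
  move=> a y z; apply: dsumP => j; rewrite linearP.
  rewrite -[LHS]/(eta j (dcomp j.+1 (a *: y + z))).
  by rewrite -[RHS]/(a *: eta j (dcomp j.+1 y) + eta j (dcomp j.+1 z)) !linearP.
exists (mklin lin); apply: dsumP => -[//|j]; rewrite !ddS.
by rewrite -[RHS]etaE.
Qed.

(** The total module [D] is projective and [dd] is exact and pure on it. Carried to the free cover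
    of [D], with the idempotent [s \o c], it has an inverse [H]; [h] is the component of [H] from
    degree [j] to degree [j]. *)
Lemma flat_complex_split j : exists h : {linear Q j -> Q j},
  forall x, d j (h x) = d j x /\ (d j x = 0 -> h x = 0).
Proof.
have [s sK] := projective_section (dsum_projective Qp).
pose c := fcover D.
have [|H HP] := @pure_periodic_inverse R D (s \o c) (s \o dd \o c).
  split=> [x|x|x|x|x|y].
  - by rewrite -[LHS]/(s (c (s (c x)))) sK.
  - by rewrite -[LHS]/(s (c (s (dd (c x))))) sK.
  - by rewrite -[LHS]/(s (dd (c (s (c x))))) sK.
  - by rewrite -[LHS]/(s (dd (c (s (dd (c x)))))) sK dd_dd linear0.
  - rewrite -[X in X = x -> _]/(s (c x)) -[X in _ -> X = 0 -> _]/(s (dd (c x))).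
    move=> ex sdx; have [y yE] : exists y, c x = dd y.
      by apply: dd_exact; rewrite -[LHS]sK -/c sdx linear0.
    by exists (s y); rewrite -[RHS]/(s (dd (c (s y)))) sK -yE.
  have [eta etaE] := dd_local (c y).
  exists (s \o eta \o c).
  by rewrite -[LHS]/(s (dd (c (s (eta (c (s (dd (c y))))))))) !sK etaE.
exists (dcomp j \o c \o H \o s \o dinj j) => x.
rewrite -[X in d j X]/(dcomp j (c (H (s (dinj j x))))).
rewrite -[X in _ -> X = 0]/(dcomp j (c (H (s (dinj j x))))).
have [h1 h2] := HP (s (dinj j x)); split.
  rewrite -!ddS.
  have := congr1 c h1; rewrite -[LHS]/(c (s (dd (c (H (s (dinj j x))))))).
  rewrite -[X in _ = X -> _]/(c (s (dd (c (s (dinj j x)))))) !sK => ->.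
  by rewrite ddS dcomp_dinj.
move=> dx; rewrite h2 ?linear0 //.
rewrite -[LHS]/(s (dd (c (s (dinj j x))))) sK.
have -> : dd (dinj j x) = 0; last by rewrite linear0.
apply: dsumP => -[|i]; rewrite linear0 // ddS.
have [->|ij] := pselect (i = j); first by rewrite dcomp_dinj.
by rewrite dcomp_dinj0 // linear0.
Qed.

End Complex.


(** * Finiteness of silp *)

Lemma horseshoe_iter (R : pzRingType) k n (A B C : lmodType R)
    (f : {linear A -> B}) (g : {linear B -> C}) : ses f g -> pd_le n B ->
  exists (B' : lmodType R) (f' : {linear iter k Omega A -> B'})
    (g' : {linear B' -> iter k Omega C}), ses f' g' /\ pd_le (n - k) B'.
Proof.
elim: k => [|k IH] fg pdB; first by exists B, f, g; rewrite subn0.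
have [B' [f' [g' [fg' pdB']]]] := IH fg pdB.
by rewrite subnS; apply: horseshoe fg' pdB'.
Qed.

(** The character modules of the syzygies of [M] are cosyzygies of its character module, by
    dualizing free covers. *)
Lemma id_le_chr_Omega (R S : pzRingType) (t : antiiso R S) n (M : lmodType R) :
  id_le n (character t M) -> is_injective (character t (iter n Omega M)).
Proof.
elim: n M => [|n IH] M H; first by apply/(id_le_Sigma 0).
rewrite iterSr; apply: IH.
have Ei := chr_projective (t := t) (@freemod_projective R M).
by have [_ shift] := id_le_shift n (ses_chr t (ses_Omega M)) Ei; apply: shift.
Qed.

(** The sequences splice to an exact complex F_0 -> Q_0 -> Q_1 -> ... of projectives. Flatness of
    the [F j] makes it pure, and its splitting exhibits F_{j+1} as a retract of Q_j. *)
Lemma flat_coresolution_projective (R S : pzRingType) (t : antiiso R S)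
    (F Q : nat -> lmodType R) (f : forall j, {linear F j -> Q j})
    (g : forall j, {linear Q j -> F j.+1}) :
  (forall j, ses (f j) (g j)) -> (forall j, is_projective (Q j)) ->
  (forall j, is_injective (character t (F j))) -> is_projective (F 0%N) ->
  forall j, is_projective (F j).
Proof.
move=> fg Qp Fi F0p.
pose T j : lmodType R := if j is i.+1 then Q i else F 0%N.
pose d j : {linear T j -> T j.+1} :=
  match j with
  | 0 => (f 0%N : {linear T 0%N -> T 1%N})
  | i.+1 => (f i.+1 \o g i : {linear T i.+1 -> T i.+2})
  end.
have Tp j : is_projective (T j) by case: j.
have fi j : injective (f j) by case: (fg j).
have fex j : exact_at (f j) (g j) by case: (fg j).
have gs j z : exists y, g j y = z by case: (fg j) => _ _; apply.
have f0 j y : f j y = 0 -> y = 0 by rewrite -[X in _ = X](linear0 (f j)) => /fi.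
have dex j : exact_at (d j) (d j.+1).
  case: j => [|j].
    suff : exact_at (f 0%N) (f 1%N \o g 0%N) by [].
    by move=> y; rewrite -fex; split=> [/f0|/= ->]; rewrite ?linear0.
  suff : exact_at (f j.+1 \o g j) (f j.+2 \o g j.+1) by [].
  move=> y; split=> [/f0/fex[x <-]|[x <-]].
    by have [z <-] := gs j x; exists z.
  by rewrite /= (ses_comp0 (fg j.+1)) linear0.
have dloc j (y : T j) : exists eta : {linear T j.+1 -> T j},
    d j (eta (d j y)) = d j y.
  case: j y => [|j] y.
    have [theta thetaE] := flat_local (fg 0%N) (Qp 0%N) (Fi 1%N) y.
    by exists theta; congr (f 0%N _).
  have [theta thetaE] := flat_local (fg j.+1) (Qp j.+1) (Fi j.+2) (g j y).
  (* [theta] has values in [F j.+1]; projectivity of [Q j.+1] lifts it along [g j] to [Q j]. *)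
  have [eta etaE] := Qp j.+1 _ _ (g j) theta (gs j).
  exists eta; rewrite -[LHS]/(f j.+1 (g j (eta (f j.+1 (g j y))))).
  by rewrite etaE thetaE.
case=> [//|j].
(* Degree [j.+1] of the spliced complex is [Q j]. There [h] kills the kernel of [g j], so it
   descends to a section of [g j]. *)
have [h hE] := @flat_complex_split R T d Tp (fi 0%N) dex dloc j.+1.
have [|s sE] := descend (h := (h : {linear Q j -> Q j})) (gs j).
  move=> y gy; have [_] := hE y; apply.
  by rewrite -[LHS]/(f j.+1 (g j y)) gy linear0.
apply: (retract_projective (s := s) (r := g j)) => // x.
have [y <-] := gs j x; rewrite sE; have [dh _] := hE y.
by apply: (fi j.+1); apply: dh.
Qed.

Section Bound.
Variables (R S : pzRingType) (t : antiiso R S) (n m : nat).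
Hypothesis Rn : forall I : lmodType R, is_injective I -> pd_le n I.
Hypothesis Sm : forall I : lmodType S, is_injective I -> pd_le m I.

Lemma projective_id_le (P : lmodType R) : is_projective P -> id_le n P.
Proof.
move=> Pp; pose C j := iter j Sigma P.
have pd0 : pd_le 0 P by apply/pd_le_Omega.
pose F j := iter n Omega (C j).
have F_ses j : exists (B : lmodType R) (f : {linear F j -> B}) (g : {linear B -> F j.+1}),
    ses f g /\ is_projective B.
  (* The middle term starts as an injective, of projective dimension at most [n], so [n] horseshoe
     steps make it projective. *)
  have [B [f [g [fg pdB]]]] :=
    horseshoe_iter n (ses_Sigma (C j)) (Rn (@icover_injective _ (C j))).
  by exists B, f, g; split=> //; apply/(pd_le_Omega 0); rewrite subnn in pdB.
have F_pd j : pd_le j (F j).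
  elim: j => [|j IH].
    by apply/(pd_le_Omega 0); have [+ _] := pd_le_Omega n P; apply; apply: pd_le_leq pd0.
  have [B [f [g [fg Bp]]]] := F_ses j.
  by have [shift _] := pd_le_shift j fg Bp; apply: shift.
pose F' j := iter m Omega (F j).
have F'_inj j : is_injective (character t (F' j)).
  (* The bound [j] is not uniform, but it is finite, so [id_le_bounded] over [S] replaces it by
     [m]. *)
  apply: id_le_chr_Omega; apply: (id_le_bounded Sm (k := j)).
  exact: pd_le_chr.
have F'_ses j : exists BB : {B : lmodType R &
      ({linear F' j -> B} * {linear B -> F' j.+1})%type},
    ses (projT2 BB).1 (projT2 BB).2 /\ is_projective (projT1 BB).
  have [B [f [g [fg Bp]]]] := F_ses j.
  have pdB : pd_le 0 B by apply/(pd_le_Omega 0).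
  have [B' [f' [g' [fg' pdB']]]] := horseshoe_iter m fg pdB.
  exists (existT _ B' (f', g')); split=> //.
  by apply/(pd_le_Omega 0); rewrite sub0n in pdB'.
pose BB j := projT1 (cid (F'_ses j)).
have BBP j : ses (projT2 (BB j)).1 (projT2 (BB j)).2 /\ is_projective (projT1 (BB j)).
  by rewrite /BB; case: cid.
have F'_proj : forall j, is_projective (F' j).
  apply: (flat_coresolution_projective (t := t) (fun j => (BBP j).1)) => // [j|].
    by case: (BBP j).
  by have [+ _] := pd_le_Omega m (F 0%N); apply; apply: pd_le_leq (F_pd 0%N).
have C_pd j : pd_le (m + n) (C j).
  by have [_] := pd_le_Omega (m + n) (C j); apply; rewrite iterD; apply: F'_proj.
(* The finite bound [m + n] is proved first and then lowered to [n] by [id_le_bounded]. *)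
apply: (id_le_bounded Rn (k := m + n)); have [_] := id_le_Sigma (m + n) P; apply.
by apply: ext1_Sigma_injective; apply: (C_pd (m + n).+1).
Qed.

End Bound.

(** [projective_id_le] bounds [silp R] by [spli R]; with [silp R] thus finite, [pd_le_bounded] gives
    the reverse inequality. *)
Lemma silp_spli (R S : pzRingType) (t : antiiso R S) :
  spli R <> natbar_oo -> spli S <> natbar_oo -> silp R = spli R.
Proof.
case ER : (spli R) => [n|//] _; case ES : (spli S) => [m|//] _.
have Rn : forall I : lmodType R, is_injective I -> pd_le n I.
  by apply/spli_le; rewrite ER /=.
have Sm : forall I : lmodType S, is_injective I -> pd_le m I.
  by apply/spli_le; rewrite ES /=.
have : natbar_le (silp R) (Some n).
  by apply/silp_le => P; apply: (projective_id_le t Rn Sm).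
case Es : (silp R) => [k|//] /= kn.
have Pk : forall P : lmodType R, is_projective P -> id_le k P.
  by apply/silp_le; rewrite Es /=.
have : natbar_le (spli R) (Some k).
  by apply/spli_le => I Ii; apply: (pd_le_bounded Pk); apply: Rn Ii.
by rewrite ER /= => nk; congr Some; apply/eqP; rewrite eqn_leq kn.
Qed.

(* Right R-modules are left modules over the converse ring R^c. *)
Theorem proposition5p3 (R : pzRingType)
    (hR : spli R <> natbar_oo) (hRop : spli R^c <> natbar_oo) :
  silp R = spli R /\ silp R^c = spli R^c.
Proof.
by split; [apply: silp_spli (anti_c R) _ _ | apply: silp_spli (c_anti R) _ _].
Qed.
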